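(* Let $f$ be a Hamiltonian stationary torus (setting in context). A multiplier $h\in\mathrm{Spec}$ of a holomorphic section determines a unique pair $(A,B)\in\mathbb C^2$, up to translation of $B$ by the dual lattice $\Gamma^*$, with $h^{A,B}=h$. Moreover, the set of multipliers of $f$ is $$\mathrm{Spec}=\{h^{A,B}\mid \Gamma^*_{A,B}\ne\varnothing\}.$$ In fact, for all $\delta\in\Gamma^*_{A,B}$ there exists a complex one-dimensional subspace $\mathcal L_{A,\delta-B}$ of the space $H^0_{A,B}:=H^0_{h^{A,B}}$ of holomorphic sections with multiplier $h^{A,B}$.
   Context: Identify $\mathbb R^4$ with $\mathbb H$ and $\mathbb C$ with $\mathrm{span}_{\mathbb R}\{1,i\}$; $\langle\cdot,\cdot\rangle$ is the Euclidean inner product on $\mathbb C\cong\mathbb R^2$. $\Gamma\subset\mathbb C$ a lattice, $\Gamma^*=\{\delta:\langle\delta,\gamma\rangle\in\mathbb Z\ \forall\gamma\in\Gamma\}$. A Hamiltonian stationary torus is a $\Gamma$-periodic conformal immersion $f:\mathbb C\to\mathbb H$ with $df=e^{j\beta/2}dz\,g$, $dz=dx+i\,dy$, $g$ nowhere zero, $\beta(z)=2\pi\langle\beta_0,z\rangle$ with $0\ne\beta_0\in\Gamma^*$. Convention $*dz=i\,dz$; left normal $N=e^{j\beta}i$. A map $\alpha:\mathbb C\to\mathbb H$ is holomorphic if $*d\alpha=N\,d\alpha$. For a homomorphism $h:\Gamma\to\mathbb C_*$, $H^0_h$ is the complex vector space (scalars on the right) of holomorphic $\alpha$ with $\alpha(z+\gamma)=\alpha(z)h(\gamma)$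 for all $\gamma\in\Gamma$, and $\mathrm{Spec}=\{h:H^0_h\ne0\}$. For $(A,B)\in\mathbb C^2$, $h^{A,B}(\gamma)=e^{2\pi(\langle A,\gamma\rangle-i\langle B,\gamma\rangle)}$, and $\Gamma^*_{A,B}=\{\delta\in\Gamma^*+\frac{\beta_0}2:\ |\delta-B|^2-|A|^2=\frac{|\beta_0|^2}4,\ \langle\delta-B,A\rangle=0\}$. *)

(* Defs.v *)
(* R : realType.
   The plane C = R^2 and the quaternions H = R^4 are row vectors ('rV[R]_2,
   'rV[R]_4), which carry the normed-module structure used for
   Frechet differentiability ('d f z). *)
From HB Require Import structures.
From mathcomp Require Import all_boot all_order all_algebra.
From mathcomp Require Import all_classical all_reals all_analysis.
Set Implicit Arguments. Unset Strict Implicit. Unset Printing Implicit Defensive.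
Import Order.TTheory GRing.Theory Num.Theory.
Import numFieldNormedType.Exports.
Local Open Scope ring_scope.

Section Defs.
Variable R : realType.

Definition cmk (a b : R) : 'rV[R]_2 := \row_(k < 2) nth 0 [:: a; b] k.
Definition cre (z : 'rV[R]_2) : R := z ord0 (inord 0).
Definition cim (z : 'rV[R]_2) : R := z ord0 (inord 1).
Definition cmul (z w : 'rV[R]_2) : 'rV[R]_2 :=
  cmk (cre z * cre w - cim z * cim w) (cre z * cim w + cim z * cre w).
Definition Jrot (v : 'rV[R]_2) : 'rV[R]_2 := cmul (cmk 0 1) v.
Definition cdot (z w : 'rV[R]_2) : R := cre z * cre w + cim z * cim w.
Definition cnorm2 (z : 'rV[R]_2) : R := cdot z z.

Definition qmk (a b c d : R) : 'rV[R]_4 := \row_(k < 4) nth 0 [:: a; b; c; d] k.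
Definition qc (n : nat) (q : 'rV[R]_4) : R := q ord0 (inord n).
Definition qmul (p q : 'rV[R]_4) : 'rV[R]_4 :=
  qmk (qc 0 p * qc 0 q - qc 1 p * qc 1 q - qc 2 p * qc 2 q - qc 3 p * qc 3 q)
      (qc 0 p * qc 1 q + qc 1 p * qc 0 q + qc 2 p * qc 3 q - qc 3 p * qc 2 q)
      (qc 0 p * qc 2 q - qc 1 p * qc 3 q + qc 2 p * qc 0 q + qc 3 p * qc 1 q)
      (qc 0 p * qc 3 q + qc 1 p * qc 2 q - qc 2 p * qc 1 q + qc 3 p * qc 0 q).
Definition c2q (z : 'rV[R]_2) : 'rV[R]_4 := qmk (cre z) (cim z) 0 0.
Definition qi : 'rV[R]_4 := qmk 0 1 0 0.
Definition qexpj (t : R) : 'rV[R]_4 := qmk (cos t) 0 (sin t) 0.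

Definition lattice_basis (w1 w2 : 'rV[R]_2) : Prop :=
  cre w1 * cim w2 - cim w1 * cre w2 != 0.
Definition inLat (w1 w2 : 'rV[R]_2) (g : 'rV[R]_2) : Prop :=
  exists m n : int, g = m%:~R *: w1 + n%:~R *: w2.
Definition inDual (w1 w2 : 'rV[R]_2) (d : 'rV[R]_2) : Prop :=
  forall g, inLat w1 w2 g -> exists k : int, cdot d g = k%:~R.

Definition betaf (b0 : 'rV[R]_2) (z : 'rV[R]_2) : R := 2 * pi * cdot b0 z.
Definition Nnormal (b0 : 'rV[R]_2) (z : 'rV[R]_2) : 'rV[R]_4 :=
  qmul (qexpj (betaf b0 z)) qi.

Definition ham_stationary_torus (w1 w2 b0 : 'rV[R]_2)
    (f g : 'rV[R]_2 -> 'rV[R]_4) : Prop :=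
  lattice_basis w1 w2 /\ inDual w1 w2 b0 /\ b0 != 0 /\
  (forall z gam, inLat w1 w2 gam -> f (z + gam) = f z) /\
  (forall z, g z != 0) /\
  (forall z, differentiable f z /\
     forall v, 'd f z v = qmul (qmul (qexpj (betaf b0 z / 2)) (c2q v)) (g z)).

(** alpha is holomorphic: *d alpha = N d alpha, where ( *w)(v) = w(J v)
    (the convention *dz = i dz). *)
Definition holomorphic (b0 : 'rV[R]_2) (a : 'rV[R]_2 -> 'rV[R]_4) : Prop :=
  forall z, differentiable a z /\
    forall v, 'd a z (Jrot v) = qmul (Nnormal b0 z) ('d a z v).

(** h : Gamma -> C_* is a group homomorphism (h is given as a function on the
    plane, only its values on Gamma matter). *)
Definition lat_hom (w1 w2 : 'rV[R]_2) (h : 'rV[R]_2 -> 'rV[R]_2) : Prop :=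
  (forall g, inLat w1 w2 g -> h g != 0) /\
  (forall g g', inLat w1 w2 g -> inLat w1 w2 g' -> h (g + g') = cmul (h g) (h g')).

Definition H0 (w1 w2 b0 : 'rV[R]_2) (h : 'rV[R]_2 -> 'rV[R]_2)
    (a : 'rV[R]_2 -> 'rV[R]_4) : Prop :=
  holomorphic b0 a /\
  forall z gam, inLat w1 w2 gam -> a (z + gam) = qmul (a z) (c2q (h gam)).

Definition Spec (w1 w2 b0 : 'rV[R]_2) (h : 'rV[R]_2 -> 'rV[R]_2) : Prop :=
  lat_hom w1 w2 h /\ exists a, H0 w1 w2 b0 h a /\ a <> (fun _ => 0).

(** h^{A,B}(gamma) = exp(2 pi (<A,gamma> - i <B,gamma>)) *)
Definition hAB (A B : 'rV[R]_2) (gam : 'rV[R]_2) : 'rV[R]_2 :=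
  expR (2 * pi * cdot A gam) *:
    cmk (cos (2 * pi * cdot B gam)) (- sin (2 * pi * cdot B gam)).

Definition GammaAB (w1 w2 b0 A B : 'rV[R]_2) (d : 'rV[R]_2) : Prop :=
  inDual w1 w2 (d - (2%:R)^-1 *: b0) /\
  cnorm2 (d - B) - cnorm2 A = cnorm2 b0 / 4 /\
  cdot (d - B) A = 0.

Definition complex_line (L : ('rV[R]_2 -> 'rV[R]_4) -> Prop) : Prop :=
  exists a : 'rV[R]_2 -> 'rV[R]_4, a <> (fun _ => 0) /\
    forall b, L b <-> exists c : 'rV[R]_2, b = (fun z => qmul (a z) (c2q c)).

End Defs.

(* Main.v *)
(** Write alpha = e^{j beta/2} (u + j v) with u, v complex-valued.  Then alpha is
    holomorphic iff (u, v) solves a constant-coefficient Dirac equation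
    u_zbar = (pi/2) beta_0 v, v_z = - (pi/2) conj(beta_0) u.  Multiplying by
    exp(-2 pi <A,z> - 2 pi i <delta - B,z>), delta in Gamma^* + beta_0/2, turns a
    section with multiplier h^{A,B} into a Gamma-periodic solution of a twisted
    equation; integrating over a period gives a 2x2 linear system for the mean
    values of (u, v), whose determinant vanishes iff delta is in Gamma^*_{A,B}.
    So if Gamma^*_{A,B} is empty, all Fourier coefficients vanish, hence alpha = 0;
    conversely the kernel of the system at a resonant delta is an exponential
    solution.

    Sections are only assumed differentiable, so a mean of derivatives cannot be
    integrated by parts.  The divergence theorem is proved in Goursat's manner, by
    bisection, and for averages over dyadic grids instead of integrals; Fourier
    uniqueness is obtained by testing against powers of a trigonometric polynomial
    peaked at the origin. *)
Require Import Defs.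
From HB Require Import structures.
From mathcomp Require Import all_boot all_order all_algebra.
From mathcomp Require Import all_classical all_reals all_analysis.
From mathcomp Require Import ring lra zify.
Import Order.TTheory GRing.Theory Num.Theory.
Local Open Scope ring_scope.

Set Implicit Arguments. Unset Strict Implicit. Unset Printing Implicit Defensive.
Import numFieldNormedType.Exports.

(** * Averages over dyadic grids *)

Section Grid.
Variable R : realType.
Local Open Scope classical_set_scope.
Implicit Types (F G X phi : R -> R -> R) (a b s t x y h L e : R).

(** * Pointwise differentiability in two variables and induction over bisected squares *)

Definition differentiable2 F s t p q := forall e, 0 < e ->
  exists2 r, 0 < r & forall x y, `|x - s| < r -> `|y - t| < r ->
    `|F x y - F s t - p * (x - s) - q * (y - t)| <= e * (`|x - s| + `|y - t|).

Definition continuous2 F s t := forall e, 0 < e ->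
  exists2 r, 0 < r & forall x y, `|x - s| < r -> `|y - t| < r ->
    `|F x y - F s t| <= e.

(** Nested squares: if [P] fails on a square, it fails on one of the quarters, and iterating gives
    failing squares that shrink to a point (s, t). The local hypothesis at that point refutes the
    small ones. *)
Lemma bisection_induction (P : R -> R -> R -> Prop) :
  (forall a b L, 0 < L ->
     P a b (L / 2) -> P (a + L / 2) b (L / 2) ->
     P a (b + L / 2) (L / 2) -> P (a + L / 2) (b + L / 2) (L / 2) -> P a b L) ->
  (forall s t, exists2 r, 0 < r & forall a b L, 0 < L < r ->
     a <= s <= a + L -> b <= t <= b + L -> P a b L) ->
  forall a b L, 0 < L -> P a b L.
Proof.
move=> Psplit Ploc a0 b0 L0 L0_gt0; apply: contrapT => nP0.
pose good (u v : R * R * R) :=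
  [/\ v.2 = u.2 / 2, u.1.1 <= v.1.1 <= u.1.1 + u.2 / 2,
      u.1.2 <= v.1.2 <= u.1.2 + u.2 / 2 & ~ P v.1.1 v.1.2 v.2].
(* A choice function picks a failing quarter; where there is none to pick, its value is
   arbitrary. *)
have /choice[f fP] : forall u : R * R * R, exists v : R * R * R,
    0 < u.2 -> ~ P u.1.1 u.1.2 u.2 -> good u v.
  move=> [[a b] L] /=.
  have [[L_gt0 nP]|H] := pselect (0 < L /\ ~ P a b L); last first.
    by exists (a, b, L) => L_gt0 nP; case: H.
  apply: contrapT => /forallNP H; apply: nP.
  apply: Psplit => //; apply: contrapT => nP.
  - by apply: (H (a, b, L / 2)) => _ _; split => //=; lra.
  - by apply: (H (a + L / 2, b, L / 2)) => _ _; split => //=; lra.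
  - by apply: (H (a, b + L / 2, L / 2)) => _ _; split => //=; lra.
  - by apply: (H (a + L / 2, b + L / 2, L / 2)) => _ _; split => //=; lra.
pose u n := iter n f (a0, b0, L0).
have uP n : [/\ 0 < (u n).2, (u n).2 = L0 / 2 ^+ n & ~ P (u n).1.1 (u n).1.2 (u n).2].
  elim: n => [|n [un_gt0 unE nP]] /=; first by rewrite expr0 divr1.
  have [e _ _ nP'] := fP _ un_gt0 nP; split => //.
    by rewrite e divr_gt0.
  by rewrite e unE exprSr invfM mulrA.
have uS n : good (u n) (u n.+1) by have [un_gt0 _ nP] := uP n; exact: fP.
have nest n k : [/\ (u n).1.1 <= (u (n + k)%N).1.1,
    (u (n + k)%N).1.1 + (u (n + k)%N).2 <= (u n).1.1 + (u n).2,
    (u n).1.2 <= (u (n + k)%N).1.2 &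
    (u (n + k)%N).1.2 + (u (n + k)%N).2 <= (u n).1.2 + (u n).2].
  elim: k => [|k [H1 H2 H3 H4]]; first by rewrite addn0.
  rewrite addnS; have [E /andP[? ?] /andP[? ?] _] := uS (n + k)%N.
  by have [? _ _] := uP (n + k)%N; rewrite E; split; lra.
(* Every left end of the nested intervals lies below every right end, so the supremum of the left
   ends lies in all of them. *)
have point (c : R * R * R -> R) :
    (forall n k, c (u n) <= c (u (n + k)%N)) ->
    (forall n k, c (u (n + k)%N) + (u (n + k)%N).2 <= c (u n) + (u n).2) ->
    exists s, forall n, c (u n) <= s <= c (u n) + (u n).2.
  move=> le_lo le_hi.
  have le_ub n k : c (u k) <= c (u n) + (u n).2.
    apply: (le_trans (le_lo k n)); rewrite addnC.
    by apply: le_trans (le_hi n k); rewrite lerDl; have [/ltW] := uP (n + k)%N.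
  have hs : has_sup (range (c \o u)).
    split; first by exists (c (u 0%N)), 0%N.
    by exists (c (u 0%N) + (u 0%N).2) => _ [k _ <-]; exact: le_ub.
  exists (sup (range (c \o u))) => n; apply/andP; split.
    by apply: ub_le_sup; [exact: hs.2|exists n].
  by apply: ge_sup; [exact: hs.1|move=> _ [k _ <-]; exact: le_ub].
have [s sP] : exists s, forall n, (u n).1.1 <= s <= (u n).1.1 + (u n).2.
  by apply: (point (fun v => v.1.1)) => n k; have [] := nest n k.
have [t tP] : exists t, forall n, (u n).1.2 <= t <= (u n).1.2 + (u n).2.
  by apply: (point (fun v => v.1.2)) => n k; have [] := nest n k.
have [r r_gt0 rP] := Ploc s t.
have [n Ln] : exists n, L0 / 2 ^+ n < r.
  have H : 0 < L0 / r by rewrite divr_gt0.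
  exists (Num.truncn (L0 / r)).+1.
  rewrite ltr_pdivrMr ?exprn_gt0// mulrC -ltr_pdivrMr//.
  have /andP[_ /lt_trans->] // := truncn_itv (ltW H).
  rewrite -natrX ltr_nat; exact: ltn_expl.
have [un_gt0 unE nP] := uP n.
by apply: nP; apply: rP; rewrite ?sP ?tP// un_gt0 unE.
Qed.

(** Compactness by bisection: continuity bounds [F] near each point, and the maximum of four bounds
    passes from the quarters to the square. *)
Lemma continuous2_bounded F a b L : 0 < L -> (forall s t, continuous2 F s t) ->
  exists B, forall x y, a <= x <= a + L -> b <= y <= b + L -> `|F x y| <= B.
Proof.
move=> L_gt0 Fc; pattern a, b, L; apply: bisection_induction => // {a b L L_gt0}.
  move=> a b L L_gt0 [B1 H1] [B2 H2] [B3 H3] [B4 H4].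
  exists (Num.max (Num.max B1 B2) (Num.max B3 B4)) => x y xI yI; rewrite !le_max.
  have [xl|xr] := leP x (a + L / 2); have [yl|yr] := leP y (b + L / 2).
  - by rewrite H1//; lra.
  - by rewrite H3 ?orbT//; lra.
  - by rewrite H2 ?orbT//; lra.
  - by rewrite H4 ?orbT//; lra.
move=> s t; have [r r_gt0 rP] := Fc s t 1 ltr01; exists r => // a b L Lr sI tI.
exists (`|F s t| + 1) => x y xI yI.
have -> : F x y = F s t + (F x y - F s t) by ring.
apply: (le_trans (ler_normD _ _)); rewrite lerD2l; apply: rP; rewrite ltr_norml; lra.
Qed.

(** * Sums and averages over square grids *)

Definition gridsum n F a b h :=
  \sum_(i < n) \sum_(j < n) F (a + i%:R * h) (b + j%:R * h).

Lemma gridsum_split n1 n2 F a b h :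
  gridsum (n1 + n2) F a b h =
    \sum_(i < n1) (\sum_(j < n1) F (a + i%:R * h) (b + j%:R * h)
       + \sum_(j < n2) F (a + i%:R * h) (b + n1%:R * h + j%:R * h))
    + \sum_(i < n2) (\sum_(j < n1) F (a + n1%:R * h + i%:R * h) (b + j%:R * h)
       + \sum_(j < n2) F (a + n1%:R * h + i%:R * h) (b + n1%:R * h + j%:R * h)).
Proof.
rewrite /gridsum big_split_ord; congr (_ + _); apply: eq_bigr => i _ /=.
  rewrite big_split_ord; congr (_ + _); apply: eq_bigr => j _ //=.
  by rewrite natrD mulrDl addrA.
rewrite big_split_ord; congr (_ + _); apply: eq_bigr => j _ //=.
  by rewrite natrD mulrDl addrA.
by rewrite !natrD !mulrDl !addrA.
Qed.

(** Sampling at lower left corners makes the four subgrids disjoint, so no boundary correction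
    appears. *)
Lemma gridsum_quarters n F a b h :
  gridsum (n + n) F a b h =
    gridsum n F a b h + gridsum n F (a + n%:R * h) b h
    + (gridsum n F a (b + n%:R * h) h
       + gridsum n F (a + n%:R * h) (b + n%:R * h) h).
Proof. by rewrite gridsum_split !big_split /= addrACA. Qed.

Lemma gridsum_ge0 n F a b h :
  (forall i j, (i < n)%N -> (j < n)%N -> 0 <= F (a + i%:R * h) (b + j%:R * h)) ->
  0 <= gridsum n F a b h.
Proof. by move=> F0; apply: sumr_ge0 => i _; apply: sumr_ge0 => j _; exact: F0. Qed.

Lemma gridsum_le_widen n N F a b h : (n <= N)%N ->
  (forall i j, (i < N)%N -> (j < N)%N -> 0 <= F (a + i%:R * h) (b + j%:R * h)) ->
  gridsum n F a b h <= gridsum N F a b h.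
Proof.
move=> /subnKC <-; move: (N - n)%N => k F0; rewrite gridsum_split.
rewrite /gridsum big_split /= -addrA lerDl addr_ge0//.
  apply: sumr_ge0 => i _; apply: sumr_ge0 => j _.
  by rewrite -addrA -mulrDl -natrD F0//; have := ltn_ord i; have := ltn_ord j; lia.
apply: sumr_ge0 => i _; rewrite addr_ge0//; apply: sumr_ge0 => j _.
  by rewrite -addrA -mulrDl -natrD F0//; have := ltn_ord i; have := ltn_ord j; lia.
by rewrite -!addrA -!mulrDl -!natrD F0//; have := ltn_ord i; have := ltn_ord j; lia.
Qed.

(** A Riemann sum over the square [-1/2, 1/2)^2, a period of the functions averaged below; it is
    centred so that the origin, where the peak will sit, is interior. *)
Definition mean m F :=
  gridsum (2 ^ m) F (- 2^-1) (- 2^-1) ((2 ^+ m)^-1) / 4 ^+ m.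

Lemma meanD m F G : mean m (fun s t => F s t + G s t) = mean m F + mean m G.
Proof.
rewrite /mean -mulrDl; congr (_ / _); rewrite -big_split; apply: eq_bigr => i _ /=.
by rewrite -big_split.
Qed.

Lemma meanZ m c F : mean m (fun s t => c * F s t) = c * mean m F.
Proof.
rewrite /mean mulrA mulr_sumr; congr (_ / _); apply: eq_bigr => i _.
by rewrite mulr_sumr.
Qed.

Lemma gridsum_cst n c a b h : gridsum n (fun _ _ => c) a b h = n%:R ^+ 2 * c.
Proof.
by rewrite /gridsum !sumr_const !card_ord -mulrnA -[LHS]mulr_natl natrM expr2.
Qed.

Lemma norm_sum_le n (u : 'I_n -> R) c : (forall i, `|u i| <= c) ->
  `|\sum_(i < n) u i| <= n%:R * c.
Proof.
move=> uc; apply: (le_trans (ler_norm_sum _ _ _)).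
by apply: (le_trans (ler_sum _ (fun i _ => uc i))); rewrite sumr_const card_ord mulr_natl.
Qed.

Lemma sum_subc n (u : 'I_n -> R) c :
  \sum_(i < n) (u i - c) = \sum_(i < n) u i - n%:R * c.
Proof. by rewrite sumrB sumr_const card_ord mulr_natl. Qed.

Lemma grid_coord_itv m (i : 'I_(2 ^ m)) a L : 0 < L ->
  a <= a + i%:R * (L / 2 ^+ m) <= a + L.
Proof.
move=> L_gt0; have d_gt0 : 0 < (2 : R) ^+ m by rewrite exprn_gt0.
apply/andP; split; first by rewrite lerDl mulr_ge0// divr_ge0// ltW.
rewrite lerD2l mulrA ler_pdivrMr// mulrC ler_pM2l// -natrX ler_nat; exact: ltnW.
Qed.

(* The increment of the flux of (F, G) through a cell of side h, minus the
   integral of X over it, both discretised on the grid. *)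
Definition flux_defect F G X h x y :=
  (F (x + h) y - F x y) * h + (G x (y + h) - G x y) * h - X x y * h ^+ 2.

(** * The divergence theorem on grids *)

Lemma gridsum_flux_defect n F G X a b h :
  gridsum n (flux_defect F G X h) a b h =
    (\sum_(j < n) (F (a + n%:R * h) (b + j%:R * h) - F a (b + j%:R * h))) * h
    + (\sum_(i < n) (G (a + i%:R * h) (b + n%:R * h) - G (a + i%:R * h) b)) * h
    - gridsum n X a b h * h ^+ 2.
Proof.
(* Fluxes through interior edges telescope away, leaving the flux through the outer sides. *)
have tel (u : nat -> R) : \sum_(i < n) (u i.+1 - u i) = u n - u 0%N.
  by rewrite -(big_mkord xpredT (fun i => u i.+1 - u i)) telescope_sumr.
rewrite /gridsum /flux_defect.
under eq_bigr => i _ do rewrite sumrB big_split /=.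
rewrite sumrB big_split /=; congr (_ + _ - _).
- rewrite exchange_big mulr_suml; apply: eq_bigr => j _ /=.
  rewrite -mulr_suml; congr (_ * _).
  have := tel (fun i => F (a + i%:R * h) (b + j%:R * h)).
  rewrite /= mul0r addr0 => <-.
  by apply: eq_bigr => i _; rewrite -natr1 mulrDl mul1r addrA.
- rewrite mulr_suml; apply: eq_bigr => i _ /=.
  rewrite -mulr_suml; congr (_ * _).
  have := tel (fun j => G (a + i%:R * h) (b + j%:R * h)).
  rewrite /= mul0r addr0 => <-.
  by apply: eq_bigr => j _; rewrite -natr1 mulrDl mul1r addrA.
- by rewrite mulr_suml; apply: eq_bigr => i _; rewrite mulr_suml.
Qed.

(** The bound e L^2 is additive over the four quarters, so bisection reduces the claim to small
    squares around one point. There the first-order expansions of [F] and [G] at that point and the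
    continuity of [X] suffice. *)
Lemma flux_defect_small F G X :
  (forall s t, exists p q p' q', [/\ differentiable2 F s t p q,
     differentiable2 G s t p' q', continuous2 X s t & X s t = p + q']) ->
  forall e, 0 < e -> forall a b L, 0 < L -> exists m0, forall m, (m0 <= m)%N ->
    `|gridsum (2 ^ m) (flux_defect F G X (L / 2 ^+ m)) a b (L / 2 ^+ m)|
      <= e * L ^+ 2.
Proof.
move=> FGX e e_gt0 a b L L_gt0.
pattern a, b, L; apply: bisection_induction => // {a b L L_gt0}.
  move=> a b L L_gt0 [m1 H1] [m2 H2] [m3 H3] [m4 H4].
  (* A quarter refined m times has the mesh of the whole square refined m + 1 times. *)
  exists (maxn (maxn m1 m2) (maxn m3 m4)).+1 => -[//|m].
  rewrite ltnS !geq_max => /andP[/andP[m1m m2m] /andP[m3m m4m]].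
  move: (H1 m m1m) (H2 m m2m) (H3 m m3m) (H4 m m4m).
  have -> : L / 2 ^+ m.+1 = L / 2 / 2 ^+ m by rewrite exprS invfM mulrA.
  rewrite expnS mul2n -addnn gridsum_quarters.
  have -> : (2 ^ m)%:R * (L / 2 / 2 ^+ m) = L / 2.
    by rewrite natrX mulrCA divff ?mulr1// expf_neq0.
  have -> : (L / 2) ^+ 2 = L ^+ 2 / 4 by field.
  rewrite !ler_norml => /andP[? ?] /andP[? ?] /andP[? ?] /andP[? ?].
  by apply/andP; split; lra.
move=> s t; have [p [q [p' [q' [dF dG cX XE]]]]] := FGX s t.
(* Error budget in units of e / 9: four each for the fluxes of [F] and [G] (two end points, each at
   distance at most L in both coordinates) and one for [X]. *)
have e9 : 0 < e / 9 by rewrite divr_gt0.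
have [rF rF_gt0 HF] := dF _ e9; have [rG rG_gt0 HG] := dG _ e9.
have [rX rX_gt0 HX] := cX _ e9.
exists (Num.min rF (Num.min rG rX)); first by rewrite !lt_min rF_gt0 rG_gt0.
move=> a b L /andP[L_gt0]; rewrite !lt_min => /and3P[LF LG LX] sI tI.
exists 0%N => m _; rewrite gridsum_flux_defect.
set n := (2 ^ m)%N; set h := L / 2 ^+ m.
have nh : n%:R * h = L by rewrite natrX mulrCA divff ?mulr1// expf_neq0.
have h_gt0 : 0 < h by rewrite divr_gt0 ?exprn_gt0.
rewrite nh.
have near r x u : L < r -> a <= x <= a + L -> a <= u <= a + L -> `|x - u| < r.
  by move=> ? ? ?; rewrite ltr_norml; lra.
have nearb r x u : L < r -> b <= x <= b + L -> b <= u <= b + L -> `|x - u| < r.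
  by move=> ? ? ?; rewrite ltr_norml; lra.
have nl x u : a <= x <= a + L -> a <= u <= a + L -> `|x - u| <= L.
  by move=> ? ?; rewrite ler_norml; lra.
have nlb x u : b <= x <= b + L -> b <= u <= b + L -> `|x - u| <= L.
  by move=> ? ?; rewrite ler_norml; lra.
have aI : a <= a <= a + L by lra.
have bI : b <= b <= b + L by lra.
have aLI : a <= a + L <= a + L by lra.
have bLI : b <= b + L <= b + L by lra.
have FL (j : 'I_n) : `|F (a + L) (b + j%:R * h) - F a (b + j%:R * h) - p * L|
    <= 4 * (e / 9) * L.
  have yI := grid_coord_itv j b L_gt0; rewrite -/h in yI.
  set y := b + j%:R * h in yI *.
  have H1 := HF _ _ (near _ _ _ LF aLI sI) (nearb _ _ _ LF yI tI).
  have H2 := HF _ _ (near _ _ _ LF aI sI) (nearb _ _ _ LF yI tI).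
  have := nl _ _ aLI sI; have := nl _ _ aI sI; have := nlb _ _ yI tI.
  move=> K1 K2 K3.
  (* Both end points have the same ordinate, so the terms in q cancel in the difference of the two
     expansions. *)
  have -> : F (a + L) y - F a y - p * L =
    (F (a + L) y - F s t - p * (a + L - s) - q * (y - t))
    - (F a y - F s t - p * (a - s) - q * (y - t)) by ring.
  apply: (le_trans (ler_normB _ _)); apply: (le_trans (lerD H1 H2)).
  rewrite -mulrDr (_ : 4 * (e / 9) * L = e / 9 * (4 * L)); last by ring.
  by rewrite ler_pM2l//; lra.
have GL (i : 'I_n) : `|G (a + i%:R * h) (b + L) - G (a + i%:R * h) b - q' * L|
    <= 4 * (e / 9) * L.
  have xI := grid_coord_itv i a L_gt0; rewrite -/h in xI.
  set x := a + i%:R * h in xI *.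
  have H1 := HG _ _ (near _ _ _ LG xI sI) (nearb _ _ _ LG bLI tI).
  have H2 := HG _ _ (near _ _ _ LG xI sI) (nearb _ _ _ LG bI tI).
  have := nlb _ _ bLI tI; have := nlb _ _ bI tI; have := nl _ _ xI sI.
  move=> K1 K2 K3.
  have -> : G x (b + L) - G x b - q' * L =
    (G x (b + L) - G s t - p' * (x - s) - q' * (b + L - t))
    - (G x b - G s t - p' * (x - s) - q' * (b - t)) by ring.
  apply: (le_trans (ler_normB _ _)); apply: (le_trans (lerD H1 H2)).
  rewrite -mulrDr (_ : 4 * (e / 9) * L = e / 9 * (4 * L)); last by ring.
  by rewrite ler_pM2l//; lra.
have XL (i : 'I_n) :
    `|\sum_(j < n) (X (a + i%:R * h) (b + j%:R * h) - X s t)| <= n%:R * (e / 9).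
  apply: norm_sum_le => j; apply: HX.
    by apply: near => //; exact: grid_coord_itv.
  by apply: nearb => //; exact: grid_coord_itv.
have := norm_sum_le FL; have := norm_sum_le GL; have := norm_sum_le XL.
rewrite (sum_subc (fun j : 'I_n => F (a + L) (b + j%:R * h) - F a (b + j%:R * h))).
rewrite (sum_subc (fun i : 'I_n => G (a + i%:R * h) (b + L) - G (a + i%:R * h) b)).
move=> HXs HGs HFs.
have -> : gridsum n X a b h = \sum_(i < n) (\sum_(j < n)
    (X (a + i%:R * h) (b + j%:R * h) - X s t)) + n%:R ^+ 2 * X s t.
  rewrite /gridsum -(gridsum_cst n (X s t) a b h) -big_split /=.
  by apply: eq_bigr => i _; rewrite -big_split; apply: eq_bigr => j _; rewrite /= subrK.
set SX := \sum_(i < n) _ in HXs *.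
move: HFs HGs.
set UF := \sum_(j < n) (F _ _ - F _ _); set UG := \sum_(i < n) (G _ _ - G _ _).
set SF := UF - _; set SG := UG - _ => HFs HGs.
(* The linear parts cancel because X s t = p + q' and n h = L. *)
have -> : UF * h + UG * h - (SX + n%:R ^+ 2 * X s t) * h ^+ 2 =
    SF * h + SG * h - SX * h ^+ 2.
  by rewrite /SF /SG XE -nh; ring.
apply: (le_trans (ler_normB _ _)).
have LE : 4 * (e / 9) * L ^+ 2 = n%:R * (4 * (e / 9) * L) * h.
  by rewrite expr2 -{2}nh; ring.
have Hh : `|SF * h + SG * h| <= 4 * (e / 9) * L ^+ 2 + 4 * (e / 9) * L ^+ 2.
  apply: (le_trans (ler_normD _ _)); rewrite LE.
  by apply: lerD; rewrite normrM (gtr0_norm h_gt0) ler_pM2r.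
have HX2 : `|SX * h ^+ 2| <= e / 9 * L ^+ 2.
  rewrite normrM [`|h ^+ 2|]ger0_norm ?sqr_ge0// -nh.
  rewrite (_ : e / 9 * (n%:R * h) ^+ 2 = n%:R * (n%:R * (e / 9)) * h ^+ 2).
    by rewrite ler_wpM2r ?sqr_ge0.
  by ring.
have -> : e * L ^+ 2 = 4 * (e / 9) * L ^+ 2 + 4 * (e / 9) * L ^+ 2 + e / 9 * L ^+ 2.
  by field.
exact: lerD.
Qed.

Definition periodic2 F := forall s t, F (s + 1) t = F s t /\ F s (t + 1) = F s t.

(** By periodicity opposite sides of the unit square cancel, so the total flux defect is minus the
    average of [X]. *)
Lemma mean_divergence F G X : periodic2 F -> periodic2 G ->
  (forall s t, exists p q p' q', [/\ differentiable2 F s t p q,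
     differentiable2 G s t p' q', continuous2 X s t & X s t = p + q']) ->
  mean m X @[m --> \oo] --> (0 : R).
Proof.
move=> Fper Gper FGX; apply/cvgr0Pnorm_le => e e_gt0.
have [m0 H] := flux_defect_small FGX e_gt0 (- 2^-1) (- 2^-1) ltr01.
exists m0 => // m /= /H; rewrite gridsum_flux_defect.
have -> : (2 ^ m)%:R * (1 / 2 ^+ m) = 1 :> R.
  by rewrite natrX mulrCA divff ?mulr1// expf_neq0.
rewrite big1 => [|j _]; last by rewrite (Fper _ _).1 subrr.
rewrite big1 => [|j _]; last by rewrite (Gper _ _).2 subrr.
rewrite !mul0r !add0r normrN expr1n mulr1 div1r exprVn.
by rewrite /mean (_ : (4 : R) ^+ m = (2 ^+ m) ^+ 2)// exprAC; congr (_ ^+ _); ring.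
Qed.

(** * Fourier uniqueness by a peaked trigonometric polynomial *)

Definition peak s t : R := 2 + cos (2 * pi * s) + cos (2 * pi * t).

Lemma cos_2pi_le x y : 0 <= y <= `|x| -> `|x| <= 2^-1 ->
  cos (2 * pi * x) <= cos (2 * pi * y) :> R.
Proof.
move=> /andP[y_ge0 yx] x2; have pi0 := pi_gt0 R.
rewrite -[cos (_ * x)]cos_norm normrM (ger0_norm (_ : 0 <= 2 * pi)); last first.
  by rewrite mulr_ge0// ltW.
have H (z : R) : 0 <= z <= 2^-1 -> 2 * pi * z \in `[0, pi]%R.
  move=> /andP[z0 z2]; rewrite in_itv/= mulr_ge0 ?mulr_ge0 ?(ltW pi0)//=.
  by rewrite mulrAC ger_pMl//; lra.
rewrite leNgt ltr_cos ?H//; last 2 first.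
- by rewrite normr_ge0.
- by rewrite y_ge0 (le_trans yx).
by rewrite -leNgt ler_pM2l// mulr_gt0.
Qed.

Lemma peak_ge0 s t : 0 <= peak s t.
Proof. by have := cos_geN1 (2 * pi * s); have := cos_geN1 (2 * pi * t); rewrite /peak; lra. Qed.

(** Bernoulli's inequality makes (K / k)^n exceed M / c. *)
Lemma geometric_dominates (k K c M : R) : 0 < k -> k < K -> 0 < c ->
  exists n, M * k ^+ n <= c * K ^+ n.
Proof.
move=> k_gt0 kK c_gt0.
have q1 : 1 < K / k by rewrite ltr_pdivlMr// mul1r.
have q0 : 0 < K / k - 1 by rewrite subr_gt0.
have bernoulli n : 1 + n%:R * (K / k - 1) <= (K / k) ^+ n.
  elim: n => [|n IHn]; first by rewrite mul0r addr0 expr0.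
  rewrite exprS; apply: (le_trans _ (ler_wpM2l (ltW (lt_trans ltr01 q1)) IHn)).
  rewrite -subr_ge0 [leRHS](_ : _ = n%:R * (K / k - 1) ^+ 2).
    by apply: mulr_ge0; rewrite ?sqr_ge0.
  by rewrite -natr1; ring.
exists (Num.truncn (`|M / c| / (K / k - 1))).+1; set n := _.+1.
have Mn : M / c <= (K / k) ^+ n.
  apply: (le_trans (ler_norm _)); apply: (le_trans _ (bernoulli n)).
  apply: (@le_trans _ _ (n%:R * (K / k - 1))); last by rewrite lerDr.
  rewrite -ler_pdivrMr// ltW//.
  by have /andP[_] := truncn_itv (divr_ge0 (normr_ge0 (M / c)) (ltW q0)).
move: Mn; rewrite expr_div_n ler_pdivrMr// mulrAC ler_pdivlMr ?exprn_gt0//.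
by rewrite [c * _]mulrC.
Qed.

(** [peak] is nonnegative and attains its maximum 4 only at integer points, so its powers
    concentrate at the origin. If phi were positive there, a fixed large power would keep all fine
    averages above 1. *)
Lemma peak_nonpos phi : periodic2 phi -> (forall s t, continuous2 phi s t) ->
  (forall n, mean m (fun s t => phi s t * peak s t ^+ n) @[m --> \oo] --> (0 : R)) ->
  phi 0 0 <= 0.
Proof.
move=> phiper phic lim0; rewrite leNgt; apply/negP => phi_gt0.
set c := phi 0 0 / 2; have c_gt0 : 0 < c by rewrite divr_gt0.
have [r0 r0_gt0 r0P] := phic 0 0 _ c_gt0.
set r := Num.min (r0 / 2) 4^-1.
have r_gt0 : 0 < r by rewrite lt_min divr_gt0//= invr_gt0.
have rr0 : r < r0 by rewrite gt_min; apply/orP; left; lra.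
have r4 : r <= 4^-1 by rewrite ge_min lexx orbT.
have phi_ge x y : `|x| <= r -> `|y| <= r -> c <= phi x y.
  move=> xr yr; have := r0P x y; rewrite !subr0 => /(_ (le_lt_trans xr rr0)).
  move=> /(_ (le_lt_trans yr rr0)); rewrite ler_norml => /andP[+ _].
  by rewrite /c; lra.
have [B BP] := continuous2_bounded (- 2^-1) (- 2^-1) ltr01 phic.
have B_ge0 : 0 <= B.
  by apply: (le_trans (normr_ge0 _)); apply: (BP 0 0); lra.
have pi0 := pi_gt0 R.
(* Within the period square, [k] bounds the peak from above outside |x|, |y| <= r, and [K] bounds it
   from below on |x|, |y| <= r / 2. *)
set k := 3 + cos (2 * pi * r); set K := 2 + 2 * cos (2 * pi * (r / 2)).
(* With C = cos(pi r), the double angle formula gives K - k = 2 C (1 - C), and 0 < C < 1 since 0 <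
   pi r < pi / 2. *)
have kK : k < K.
  rewrite /k /K; set C := cos (2 * pi * (r / 2)).
  have -> : 2 * pi * r = (2 * pi * (r / 2)) *+ 2 by rewrite -mulr_natr; field.
  rewrite cos_mulr2n -/C.
  have CE : 2 * pi * (r / 2) = pi * r by field.
  have pir : 0 < pi * r by rewrite mulr_gt0.
  have pirh : pi * r < pi / 2 by rewrite ltr_pM2l//; lra.
  have /andP[C0 C1] : 0 < C < 1.
    rewrite /C CE -[X in _ && (_ < X)]cos0 cos_gt0_pihalf; last first.
      by rewrite pirh andbT (lt_trans _ pir)// oppr_lt0 divr_gt0.
    by rewrite ltr_cos// in_itv/= ?lexx ?(ltW pi0)// (ltW pir)/=; lra.
  have : 0 < (1 - C) * C by rewrite mulr_gt0// subr_gt0.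
  by rewrite -mulr_natr; lra.
have k_ge1 : 1 <= k by have := cos_geN1 (2 * pi * r); rewrite /k; lra.
(* A block of side 2^-l at the origin fits into [0, r / 2]^2 and holds the share 4^-l of the grid
   points, whence the constant c / 4^l below. *)
have [l l_gt0 lP] : exists2 l, (0 < l)%N & (2 ^+ l)^-1 <= r / 2.
  have r2_gt0 : 0 < (r / 2)^-1 by rewrite invr_gt0 divr_gt0.
  exists (Num.truncn (r / 2)^-1).+1 => //.
  rewrite -[leRHS]invrK lef_pV2 ?posrE ?exprn_gt0// -natrX ltW//.
  have /andP[_ /lt_trans->] // := truncn_itv (ltW r2_gt0).
  by rewrite ltr_nat ltn_expl.
have [n nP] : exists n, (B + 1) * k ^+ n <= (c / 4 ^+ l) * K ^+ n.
  by apply: geometric_dominates; rewrite ?divr_gt0 ?exprn_gt0//; lra.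
have lower x y : - 2^-1 <= x <= 2^-1 -> - 2^-1 <= y <= 2^-1 ->
    0 <= phi x y * peak x y ^+ n + B * k ^+ n.
  move=> xI yI.
  have [|far] := boolP ((`|x| <= r) && (`|y| <= r)).
    move=> /andP[xr yr]; rewrite addr_ge0// mulr_ge0 ?exprn_ge0 ?peak_ge0//; try lra.
    by apply: (le_trans _ (phi_ge _ _ xr yr)); exact: ltW.
  have pk : peak x y <= k.
    have x2 : `|x| <= 2^-1 by rewrite ler_norml; lra.
    have y2 : `|y| <= 2^-1 by rewrite ler_norml; lra.
    rewrite /peak /k; move: far; rewrite negb_and -!ltNge => /orP[xr|yr].
      have := @cos_2pi_le x r; rewrite (ltW xr) (ltW r_gt0) => /(_ isT x2).
      by have := cos_le1 (2 * pi * y); lra.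
    have := @cos_2pi_le y r; rewrite (ltW yr) (ltW r_gt0) => /(_ isT y2).
    by have := cos_le1 (2 * pi * x); lra.
  have : `|phi x y * peak x y ^+ n| <= B * k ^+ n.
    rewrite normrM ler_pM//; first by apply: BP; lra.
    by rewrite ger0_norm ?exprn_ge0 ?peak_ge0// lerXn2r ?nnegrE ?peak_ge0//; lra.
  by rewrite ler_norml => /andP[? _]; lra.
(* At level m + 1 the origin is a grid point, with 2^m steps on either side. *)
have mean_ge m : (l <= m)%N -> 1 <= mean m.+1 (fun s t => phi s t * peak s t ^+ n).
  move=> lm.
  (* Adding B k^n makes the summand nonnegative on the period square, so the sum can be bounded
     below by its part over the block at the origin. *)
  pose Y s t := phi s t * peak s t ^+ n + B * k ^+ n.
  have -> : (fun s t => phi s t * peak s t ^+ n) = (fun s t => Y s t + (- (B * k ^+ n))).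
    by apply/funext => s; apply/funext => t; rewrite /Y addrK.
  rewrite meanD.
  set h := (2 ^+ m.+1)^-1 : R.
  have h_gt0 : 0 < h by rewrite invr_gt0 exprn_gt0.
  have nh (j : nat) : (j <= m.+1)%N -> (2 ^ j)%:R * h = (2 ^+ (m.+1 - j))^-1.
    by move=> jm; rewrite natrX /h -{1}(subnK jm) exprD invfM mulrCA divff ?mulr1// expf_neq0.
  have m4 : 0 < (4 : R) ^+ m.+1 by rewrite exprn_gt0.
  have -> : mean m.+1 (fun _ _ => - (B * k ^+ n)) = - (B * k ^+ n).
    rewrite /mean gridsum_cst natrX.
    rewrite (_ : (4 : R) ^+ m.+1 = (2 ^+ m.+1) ^+ 2); last by rewrite exprAC; congr (_ ^+ _); ring.
    by rewrite mulrAC divff ?mul1r// expf_neq0// expf_neq0.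
  (* After B k^n is subtracted again, [nP] leaves a surplus k^n, which is at least 1. *)
  suff : c / 4 ^+ l * K ^+ n <= mean m.+1 Y.
    have : 1 <= k ^+ n by rewrite exprn_ege1.
    by move: nP; rewrite mulrDl; lra.
  rewrite /mean -/h ler_pdivlMr//.
  have -> : c / 4 ^+ l * K ^+ n * 4 ^+ m.+1 = (2 ^ (m.+1 - l))%:R ^+ 2 * (c * K ^+ n).
    rewrite natrX exprAC (_ : 2 ^+ 2 = 4 :> R); last by ring.
    by rewrite -{1}(subnK (leqW lm)) exprD; field; rewrite expf_neq0.
  rewrite -(gridsum_cst _ _ 0 0 h).
  apply: (@le_trans _ _ (gridsum (2 ^ (m.+1 - l)) Y 0 0 h)).
    apply: ler_sum => i _; apply: ler_sum => j _; rewrite !add0r.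
    have small (i' : 'I_(2 ^ (m.+1 - l))) : 0 <= i'%:R * h <= r / 2.
      rewrite mulr_ge0 ?(ltW h_gt0)//=; apply: (le_trans _ lP).
      have -> : (2 ^+ l)^-1 = (2 ^ (m.+1 - l))%:R * h by rewrite nh ?leq_subr// subKn// leqW.
      by rewrite ler_pM2r// ler_nat ltnW.
    have /andP[x0 xr] := small i; have /andP[y0 yr] := small j.
    set x := i%:R * h in x0 xr *; set y := j%:R * h in y0 yr *.
    have : c * K ^+ n <= phi x y * peak x y ^+ n.
      apply: ler_pM; first exact: ltW.
      - by rewrite exprn_ge0//; lra.
      - by apply: phi_ge; rewrite ger0_norm//; lra.
      rewrite lerXn2r ?nnegrE ?peak_ge0//; first by lra.
      have cr z : 0 <= z -> z <= r / 2 -> cos (2 * pi * (r / 2)) <= cos (2 * pi * z).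
        by move=> z0 zr; apply: cos_2pi_le; rewrite ger0_norm; lra.
      by have := cr _ x0 xr; have := cr _ y0 yr; rewrite /peak /K; lra.
    rewrite /Y; have : 0 <= B * k ^+ n by rewrite mulr_ge0// exprn_ge0//; lra.
    by lra.
  have halfE : (2 ^ m)%:R * h = 2^-1 by rewrite nh// subSnn expr1.
  have m2 : (2 ^ m.+1 = 2 ^ m + 2 ^ m)%N by rewrite expnS mul2n addnn.
  have gridI (i : nat) : (i < 2 ^ m.+1)%N -> - 2^-1 <= - 2^-1 + i%:R * h <= 2^-1.
    move=> im; rewrite lerDl mulr_ge0 ?(ltW h_gt0)//=.
    suff : i%:R * h <= 1 by lra.
    apply: (@le_trans _ _ ((2 ^ m.+1)%:R * h)); first by rewrite ler_pM2r// ler_nat ltnW.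
    by rewrite nh// subnn expr0 invr1.
  have Y_ge0 (P Q i j : nat) : (P <= 2 ^ m)%N -> (Q <= 2 ^ m)%N -> (i < 2 ^ m)%N ->
      (j < 2 ^ m)%N -> 0 <= Y (- 2^-1 + P%:R * h + i%:R * h) (- 2^-1 + Q%:R * h + j%:R * h).
    move=> Pm Qm im jm; rewrite -!addrA -!mulrDl -!natrD.
    by apply: lower; apply: gridI; rewrite m2 -addnS leq_add.
  have pos (P Q : nat) : (P <= 2 ^ m)%N -> (Q <= 2 ^ m)%N ->
      0 <= gridsum (2 ^ m) Y (- 2^-1 + P%:R * h) (- 2^-1 + Q%:R * h) h.
    by move=> Pm Qm; apply: gridsum_ge0 => i j im jm; exact: Y_ge0.
  have -> : gridsum (2 ^ (m.+1 - l)) Y 0 0 h =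
      gridsum (2 ^ (m.+1 - l)) Y (- 2^-1 + (2 ^ m)%:R * h) (- 2^-1 + (2 ^ m)%:R * h) h.
    by rewrite halfE addNr.
  apply: (@le_trans _ _ (gridsum (2 ^ m) Y (- 2^-1 + (2 ^ m)%:R * h)
                           (- 2^-1 + (2 ^ m)%:R * h) h)).
    apply: gridsum_le_widen => [|i j im jm]; last exact: Y_ge0.
    by rewrite leq_exp2l// leq_subLR -add1n leq_add.
  rewrite [in leRHS]m2 gridsum_quarters -[leLHS]add0r lerD//.
    apply: addr_ge0; first by have := pos 0%N 0%N; rewrite mul0r addr0; apply.
    by have := pos (2 ^ m)%N 0%N; rewrite mul0r addr0; apply.
  by rewrite lerDr; have := pos 0%N (2 ^ m)%N; rewrite mul0r addr0; apply.
have half : (0 : R) < 2^-1 by rewrite invr_gt0.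
have /cvgr0Pnorm_le /(_ _ half) [m0 _ m0P] := lim0 n.
have := m0P (maxn m0 l).+1 (leqW (leq_maxl _ _)) => /= H.
have := mean_ge (maxn m0 l) (leq_maxr _ _).
by move: H; rewrite ler_norml => /andP[_ ?]; lra.
Qed.

Definition wave (m n : int) s t := cos (2 * pi * (m%:~R * s + n%:~R * t)).

Lemma peak_wave m n s t :
  peak s t * wave m n s t = 2 * wave m n s t
    + 2^-1 * (wave (m + 1) n s t + wave (m - 1) n s t)
    + 2^-1 * (wave m (n + 1) s t + wave m (n - 1) s t).
Proof.
rewrite /wave; set x := 2 * pi * (m%:~R * s + n%:~R * t).
rewrite (_ : 2 * pi * ((m + 1)%:~R * s + n%:~R * t) = x + 2 * pi * s); last by rewrite /x intrD; ring.
rewrite (_ : 2 * pi * ((m - 1)%:~R * s + n%:~R * t) = x - 2 * pi * s); last by rewrite /x intrD; ring.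
rewrite (_ : 2 * pi * (m%:~R * s + (n + 1)%:~R * t) = x + 2 * pi * t); last by rewrite /x intrD; ring.
rewrite (_ : 2 * pi * (m%:~R * s + (n - 1)%:~R * t) = x - 2 * pi * t); last by rewrite /x intrD; ring.
by rewrite !cosB !cosD /peak; field.
Qed.

Lemma cvg0D (u v : nat -> R) : u m @[m --> \oo] --> (0 : R) ->
  v m @[m --> \oo] --> (0 : R) -> (u m + v m) @[m --> \oo] --> (0 : R).
Proof. by move=> hu hv; rewrite -[0 in X in _ --> X](addr0 0); exact: cvgD. Qed.

Lemma cvg0Z c (u : nat -> R) : u m @[m --> \oo] --> (0 : R) ->
  (c * u m) @[m --> \oo] --> (0 : R).
Proof. by move=> hu; rewrite -[0 in X in _ --> X](mulr0 c); apply: cvgM => //; exact: cvg_cst. Qed.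

Definition negligible phi := mean m phi @[m --> \oo] --> (0 : R).

Lemma negligibleD F G : negligible F -> negligible G ->
  negligible (fun s t => F s t + G s t).
Proof. by move=> hF hG; rewrite /negligible; under eq_fun do rewrite meanD; exact: cvg0D. Qed.

Lemma negligibleZ c F : negligible F -> negligible (fun s t => c * F s t).
Proof. by move=> hF; rewrite /negligible; under eq_fun do rewrite meanZ; exact: cvg0Z. Qed.

Lemma eq_negligible F G : (forall s t, F s t = G s t) -> negligible F -> negligible G.
Proof. by move=> FG; rewrite (_ : F = G)//; apply/funext => s; apply/funext => t. Qed.

(** The induction on the power runs over all frequencies at once, since each step calls on the
    neighbouring ones. *)
Lemma negligible_peak_power phi :
  (forall m n, negligible (fun s t => phi s t * wave m n s t)) ->
  forall k m n, negligible (fun s t => phi s t * peak s t ^+ k * wave m n s t).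
Proof.
move=> H; elim=> [|k IHk] m n.
  by apply: eq_negligible (H m n) => s t; rewrite expr0 mulr1.
have := negligibleZ 2 (IHk m n).
have := negligibleZ 2^-1 (negligibleD (IHk (m + 1) n) (IHk (m - 1) n)).
have := negligibleZ 2^-1 (negligibleD (IHk m (n + 1)) (IHk m (n - 1))).
move=> H1 H2 H3; apply: eq_negligible (negligibleD H3 (negligibleD H2 H1)) => s t.
rewrite [RHS](_ : _ = phi s t * peak s t ^+ k * (peak s t * wave m n s t)).
  by rewrite peak_wave; ring.
by rewrite exprSr; ring.
Qed.

(** [peak_nonpos] is applied to phi and to - phi. Powers of the peak expand into cosine waves only,
    so no sines are tested. *)
Lemma fourier_uniqueness phi : periodic2 phi -> (forall s t, continuous2 phi s t) ->
  (forall m n, negligible (fun s t => phi s t * wave m n s t)) -> phi 0 0 = 0.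
Proof.
move=> phiper phic H.
have Hk k : negligible (fun s t => phi s t * peak s t ^+ k).
  apply: eq_negligible (negligible_peak_power H k 0 0) => s t.
  by rewrite /wave !mul0r addr0 mulr0 cos0 mulr1.
apply/eqP; rewrite eq_le peak_nonpos//= -oppr_le0.
apply: (@peak_nonpos (fun s t => - phi s t)) => [s t|s t e e0|k].
- by rewrite (phiper s t).1 (phiper s t).2.
- have [r r0 rP] := phic s t e e0; exists r => // x y xr yr.
  by rewrite -opprD normrN; exact: rP.
- by apply: eq_negligible (negligibleZ (-1) (Hk k)) => s t; rewrite mulN1r mulNr.
Qed.

End Grid.

(** * Gradients and the Dirac equation *)

Section Gradient.
Variable R : realType.
Implicit Types (phi psi : 'rV[R]_2 -> R) (z w v : 'rV[R]_2).

Lemma ord2E (k : 'I_2) : k = inord 0 \/ k = inord 1.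
Proof. by case: k => [[|[|//]] H]; [left|right]; apply/val_inj; rewrite /= inordK. Qed.

Lemma cre_cmk (a b : R) : cre (cmk a b) = a.
Proof. by rewrite /cre mxE inordK. Qed.

Lemma cim_cmk (a b : R) : cim (cmk a b) = b.
Proof. by rewrite /cim mxE inordK. Qed.

Lemma eq_plane z w : cre z = cre w -> cim z = cim w -> z = w.
Proof.
by move=> zw0 zw1; apply/rowP => k; case: (ord2E k) => ->; [exact: zw0|exact: zw1].
Qed.

Lemma creD z w : cre (z + w) = cre z + cre w. Proof. by rewrite /cre mxE. Qed.
Lemma cimD z w : cim (z + w) = cim z + cim w. Proof. by rewrite /cim mxE. Qed.
Lemma creN z : cre (- z) = - cre z. Proof. by rewrite /cre mxE. Qed.
Lemma cimN z : cim (- z) = - cim z. Proof. by rewrite /cim mxE. Qed.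
Lemma creZ (c : R) z : cre (c *: z) = c * cre z. Proof. by rewrite /cre mxE. Qed.
Lemma cimZ (c : R) z : cim (c *: z) = c * cim z. Proof. by rewrite /cim mxE. Qed.
Lemma cre0 : cre (0 : 'rV[R]_2) = 0. Proof. by rewrite /cre mxE. Qed.
Lemma cim0 : cim (0 : 'rV[R]_2) = 0. Proof. by rewrite /cim mxE. Qed.

Lemma cdotDr w z z' : cdot w (z + z') = cdot w z + cdot w z'.
Proof. by rewrite /cdot creD cimD; ring. Qed.
Lemma cdotDl w w' z : cdot (w + w') z = cdot w z + cdot w' z.
Proof. by rewrite /cdot creD cimD; ring. Qed.
Lemma cdotNl w z : cdot (- w) z = - cdot w z.
Proof. by rewrite /cdot creN cimN; ring. Qed.
Lemma cdotZl c w z : cdot (c *: w) z = c * cdot w z.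
Proof. by rewrite /cdot creZ cimZ; ring. Qed.

(** A relation, so that the rules below compute p and q by unification. *)
Definition has_grad phi z (p q : R) := is_diff z phi (fun v => p * cre v + q * cim v).

Lemma is_diff_coord m n (M : 'M[R]_(m, n)) i j :
  is_diff M (fun N : 'M[R]_(m, n) => N i j) (fun N => N i j).
Proof.
have @f : {linear 'M[R]_(m, n) -> R}.
  by exists (fun N : 'M[R]_(_, _) => N i j); do 2![eexists]; do ?[constructor];
     rewrite ?mxE// => ? *; rewrite ?mxE//; move=> ?; rewrite !mxE.
have fc : continuous f by exact: coord_continuous.
by apply: (@DiffDef _ _ _ _ _ f); [exact: linear_differentiable|exact: diff_lin].
Qed.

Lemma eq_grad phi z p q p' q' : p = p' -> q = q' -> has_grad phi z p q ->
  has_grad phi z p' q'.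
Proof. by move=> <- <-. Qed.

Lemma grad_cst (c : R) z : has_grad (fun=> c) z 0 0.
Proof.
have H := is_diff_cst c z; apply: is_diff_eq H _.
by apply/funext => v; rewrite !mul0r addr0.
Qed.

Lemma gradD phi psi z p q p' q' : has_grad phi z p q -> has_grad psi z p' q' ->
  has_grad (fun z => phi z + psi z) z (p + p') (q + q').
Proof.
move=> H1 H2; have H := is_diffD H1 H2; apply: is_diff_eq H _.
by apply/funext => v; rewrite fctE; ring.
Qed.

Lemma gradM phi psi z p q p' q' : has_grad phi z p q -> has_grad psi z p' q' ->
  has_grad (fun z => phi z * psi z) z
    (phi z * p' + psi z * p) (phi z * q' + psi z * q).
Proof.
move=> H1 H2; have H := is_diffM H1 H2; apply: is_diff_eq H _.
by apply/funext => v; rewrite !fctE /GRing.scale /=; ring.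
Qed.

Lemma gradZ (c : R) phi z p q : has_grad phi z p q ->
  has_grad (fun z => c * phi z) z (c * p) (c * q).
Proof.
by move=> H; apply: eq_grad (gradM (grad_cst c z) H); rewrite mulr0 addr0.
Qed.

Lemma gradN phi z p q : has_grad phi z p q -> has_grad (fun z => - phi z) z (- p) (- q).
Proof.
move=> H; rewrite (_ : (fun z => - phi z) = (fun z => -1 * phi z)).
  by apply: eq_grad (gradZ (-1) H); rewrite mulN1r.
by apply/funext => x; rewrite mulN1r.
Qed.

Lemma grad_cdot w z : has_grad (cdot w) z (cre w) (cim w).
Proof.
have re : has_grad (@cre R) z 1 0.
  apply: is_diff_eq (is_diff_coord z ord0 (inord 0)) _.
  by apply/funext => v; rewrite mul1r mul0r addr0.
have im : has_grad (@cim R) z 0 1.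
  apply: is_diff_eq (is_diff_coord z ord0 (inord 1)) _.
  by apply/funext => v; rewrite mul1r mul0r add0r.
by apply: eq_grad (gradD (gradZ (cre w) re) (gradZ (cim w) im)); ring.
Qed.

Lemma grad_comp (g : R -> R) (dg : R) phi z p q : is_derive (phi z) 1 g dg ->
  has_grad phi z p q -> has_grad (fun z => g (phi z)) z (dg * p) (dg * q).
Proof.
move=> gd H.
have Hg : is_diff (phi z) g (fun h => h * dg).
  have dg1 : differentiable g (phi z) by apply/derivable1_diffP; exact: ex_derive.
  apply: DiffDef => //; rewrite diff1E//; apply/funext => h.
  by rewrite derive1E derive_val.
have H' := is_diff_comp H Hg; apply: is_diff_eq H' _.
by apply/funext => v /=; ring.
Qed.

Lemma grad_shift phi z z0 p q : has_grad phi (z + z0) p q ->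
  has_grad (fun z => phi (z + z0)) z p q.
Proof.
move=> H.
have Hs : is_diff z (fun z => z + z0) id.
  apply: is_diff_eq (is_diffD (is_diff_id z) (is_diff_cst z0 z)) _.
  by apply/funext => v; rewrite fctE /= addr0.
by have := @is_diff_comp _ _ _ _ _ _ phi _ z Hs H.
Qed.

Lemma grad_unique phi z p q p' q' : has_grad phi z p q -> has_grad phi z p' q' ->
  p = p' /\ q = q'.
Proof.
move=> [_ e] [_]; rewrite e => pq.
have H v : p * cre v + q * cim v = p' * cre v + q' * cim v.
  by have := congr1 (fun f : 'rV[R]_2 -> R => f v) pq.
have := H (cmk 1 0); have := H (cmk 0 1).
by rewrite !cre_cmk !cim_cmk !mulr0 !mulr1 !add0r !addr0.
Qed.

(** The chain rule for the linear map (s, t) |-> s w1 + t w2, which carries Frechet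
    differentiability to the epsilon form used on grids. *)
Lemma grad_differentiable2 phi w1 w2 (s t p q : R) : has_grad phi (s *: w1 + t *: w2) p q ->
  differentiable2 (fun s t => phi (s *: w1 + t *: w2)) s t
    (p * cre w1 + q * cim w1) (p * cre w2 + q * cim w2).
Proof.
move=> [d dE] e e_gt0; set z := s *: w1 + t *: w2 in d dE.
(* [M] bounds the norm of that linear map; the summand 1 keeps it positive. *)
pose M := `|w1| + `|w2| + 1.
have M_gt0 : 0 < M by rewrite ltr_wpDl ?addr_ge0.
have /diff_locallyP[_ /eqaddoP] := d.
move=> /(_ (e / M)); rewrite divr_gt0// => /(_ isT) /nbhs_ballP[r /= r_gt0 rP].
exists (r / (M * 2)); first by rewrite divr_gt0// mulr_gt0.
move=> x y xr yr.
set h := (x - s) *: w1 + (y - t) *: w2.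
have hM : `|h| <= M * (`|x - s| + `|y - t|).
  apply: (le_trans (ler_normD _ _)); rewrite !normrZ mulrDr.
  by apply: lerD; rewrite mulrC ler_wpM2r// /M -?addrA ?lerDl ?addr_ge0// addrCA lerDl addr_ge0.
have hr : `|h| < r.
  apply: (le_lt_trans hM); rewrite -ltr_pdivlMl//.
  have -> : M^-1 * r = r / (M * 2) + r / (M * 2) by field; rewrite gt_eqF.
  exact: ltrD.
have := rP h; rewrite -ball_normE /= sub0r normrN => /(_ hr).
rewrite !fctE dE => H.
have -> : x *: w1 + y *: w2 = h + z.
  by rewrite /h /z addrACA -!scalerDl !subrK.
have E : phi (h + z) - phi z - (p * cre w1 + q * cim w1) * (x - s)
    - (p * cre w2 + q * cim w2) * (y - t)
  = phi (h + z) - (phi z + (p * cre h + q * cim h)).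
  by rewrite /h creD cimD !creZ !cimZ; ring.
rewrite E; apply: (le_trans H).
by rewrite -mulrA ler_pM2l// mulrC ler_pdivrMr// mulrC.
Qed.

Lemma differentiable2_continuous2 F (s t p q : R) : differentiable2 F s t p q ->
  continuous2 F s t.
Proof.
move=> d e e_gt0; have [r r_gt0 rP] := d 1 ltr01.
pose M := `|p| + `|q| + 2.
have M_gt0 : 0 < M by rewrite ltr_wpDl ?addr_ge0.
exists (Num.min r (e / M)); first by rewrite lt_min r_gt0 divr_gt0.
move=> x y; rewrite !lt_min => /andP[xr xe] /andP[yr ye].
have := rP x y xr yr; rewrite mul1r => H.
rewrite ltr_pdivlMr// in xe; rewrite ltr_pdivlMr// in ye.
have -> : F x y - F s t = (F x y - F s t - p * (x - s) - q * (y - t))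
   + (p * (x - s) + q * (y - t)) by ring.
apply: (le_trans (ler_normD _ _)); apply: (le_trans (lerD H (ler_normD _ _))).
rewrite !normrM.
set X := `|x - s| in xe *; set Y := `|y - t| in ye *.
have X0 : 0 <= X by exact: normr_ge0.
have Y0 : 0 <= Y by exact: normr_ge0.
have XY : X + Y + (`|p| * X + `|q| * Y) <= Num.max X Y * M.
  have hX : X <= Num.max X Y by rewrite le_max lexx.
  have hY : Y <= Num.max X Y by rewrite le_max lexx orbT.
  have := ler_wpM2l (normr_ge0 p) hX; have := ler_wpM2l (normr_ge0 q) hY.
  by rewrite /M; lra.
apply: (le_trans XY); case: (leP X Y) => _; exact: ltW.
Qed.

End Gradient.

(** * The twisted Dirac system and its symmetries *)

Section Dirac.
Variable R : realType.
Implicit Types (phi psi : 'rV[R]_2 -> R) (z w v b A C D : 'rV[R]_2).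
Implicit Types (U V : 'rV[R]_2 -> R).

(* With U = U0 + i U1, V = V0 + i V1, k = A + i C and k' = conj A + i conj C:
   U_x + i U_y = pi b0 V - 2 pi k U  and  V_x - i V_y = - pi conj(b0) U - 2 pi k' V. *)
Definition dirac b0 A C U0 U1 V0 V1 := forall z,
  exists p0 q0 p1 q1 r0 s0 r1 s1,
  [/\ has_grad U0 z p0 q0, has_grad U1 z p1 q1,
      has_grad V0 z r0 s0 & has_grad V1 z r1 s1] /\
  [/\ p0 - q1 = pi * (cre b0 * V0 z - cim b0 * V1 z)
        - 2 * pi * ((cre A - cim C) * U0 z - (cim A + cre C) * U1 z),
      p1 + q0 = pi * (cre b0 * V1 z + cim b0 * V0 z)
        - 2 * pi * ((cre A - cim C) * U1 z + (cim A + cre C) * U0 z),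
      r0 + s1 = - (pi * (cre b0 * U0 z + cim b0 * U1 z))
        - 2 * pi * ((cre A + cim C) * V0 z - (cre C - cim A) * V1 z) &
      r1 - s0 = - (pi * (cre b0 * U1 z - cim b0 * U0 z))
        - 2 * pi * ((cre A + cim C) * V1 z + (cre C - cim A) * V0 z)].

(* twist_re + i twist_im = exp(- 2 pi <A, z> - 2 pi i <C, z>) (U0 + i U1). *)
Definition damp A z : R := expR (- (2 * pi * cdot A z)).
Definition twist_re A C U0 U1 z : R :=
  damp A z * (cos (2 * pi * cdot C z) * U0 z + sin (2 * pi * cdot C z) * U1 z).
Definition twist_im A C U0 U1 z : R :=
  damp A z * (cos (2 * pi * cdot C z) * U1 z - sin (2 * pi * cdot C z) * U0 z).

Lemma grad_scaled_cdot (c : R) w z :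
  has_grad (fun z => c * cdot w z) z (c * cre w) (c * cim w).
Proof. exact: gradZ (grad_cdot w z). Qed.

Lemma grad_cos_cdot (c : R) w z : has_grad (fun z => cos (c * cdot w z)) z
  (- sin (c * cdot w z) * (c * cre w)) (- sin (c * cdot w z) * (c * cim w)).
Proof. exact: (grad_comp (is_derive_cos _) (grad_scaled_cdot c w z)). Qed.

Lemma grad_sin_cdot (c : R) w z : has_grad (fun z => sin (c * cdot w z)) z
  (cos (c * cdot w z) * (c * cre w)) (cos (c * cdot w z) * (c * cim w)).
Proof. exact: (grad_comp (is_derive_sin _) (grad_scaled_cdot c w z)). Qed.

Lemma grad_damp A z : has_grad (damp A) z
  (damp A z * (- (2 * pi * cre A))) (damp A z * (- (2 * pi * cim A))).
Proof. exact: (grad_comp (is_derive_expR _) (gradN (grad_scaled_cdot (2 * pi) A z))). Qed.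

(** Product rule: d_x + i d_y and d_x - i d_y map the exponent - 2 pi <A', z> - 2 pi i <C', z> to
    the constants - 2 pi (A' + i C') and - 2 pi (conj A' + i conj C'), which add to the old ones. *)
Lemma dirac_twist b0 A C A' C' U0 U1 V0 V1 : dirac b0 A C U0 U1 V0 V1 ->
  dirac b0 (A + A') (C + C') (twist_re A' C' U0 U1) (twist_im A' C' U0 U1)
    (twist_re A' C' V0 V1) (twist_im A' C' V0 V1).
Proof.
move=> H z; have [p0 [q0 [p1 [q1 [r0 [s0 [r1 [s1 [[gU0 gU1 gV0 gV1] [E1 E2 E3 E4]]]]]]]]]] := H z.
have gc := grad_cos_cdot (2 * pi) C' z; have gs := grad_sin_cdot (2 * pi) C' z.
have gd := grad_damp A' z.
have re W0 W1 x0 y0 x1 y1 (g0 : has_grad W0 z x0 y0) (g1 : has_grad W1 z x1 y1) :=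
  gradM gd (gradD (gradM gc g0) (gradM gs g1)).
have im W0 W1 x0 y0 x1 y1 (g0 : has_grad W0 z x0 y0) (g1 : has_grad W1 z x1 y1) :=
  gradM gd (gradD (gradM gc g1) (gradN (gradM gs g0))).
do 8 eexists; split; first by split;
  [exact: re gU0 gU1|exact: im gU0 gU1|exact: re gV0 gV1|exact: im gV0 gV1].
rewrite /twist_re /twist_im !creD !cimD.
(* Solving the equations for the x-derivatives and substituting leaves polynomial identities. *)
move: E1 E2 E3 E4 => /eqP; rewrite subr_eq => /eqP E1 /eqP; rewrite eq_sym -subr_eq eq_sym => /eqP E2.
move=> /eqP; rewrite eq_sym -subr_eq eq_sym => /eqP E3 /eqP; rewrite subr_eq => /eqP E4.
subst p0 p1 r0 r1.
move: (damp A' z) (cos _) (sin _) => d c s.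
by split; ring.
Qed.

Lemma dirac_shift b0 A C U0 U1 V0 V1 z0 : dirac b0 A C U0 U1 V0 V1 ->
  dirac b0 A C (fun z => U0 (z + z0)) (fun z => U1 (z + z0))
    (fun z => V0 (z + z0)) (fun z => V1 (z + z0)).
Proof.
move=> H z; have [p0 [q0 [p1 [q1 [r0 [s0 [r1 [s1 [[? ? ? ?] E]]]]]]]]] := H (z + z0).
by exists p0, q0, p1, q1, r0, s0, r1, s1; split => //; split; exact: grad_shift.
Qed.

(** The system is complex linear; multiplication by - i moves the imaginary part of U into the place
    of the real part. *)
Lemma dirac_rotate b0 A C U0 U1 V0 V1 : dirac b0 A C U0 U1 V0 V1 ->
  dirac b0 A C U1 (fun z => - U0 z) V1 (fun z => - V0 z).
Proof.
move=> H z; have [p0 [q0 [p1 [q1 [r0 [s0 [r1 [s1 [[? ? ? ?] [E1 E2 E3 E4]]]]]]]]]] := H z.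
exists p1, q1, (- p0), (- q0), r1, s1, (- r0), (- s0); split.
  by split => //; exact: gradN.
have E1' : - p0 + q1 = - (p0 - q1) by ring.
split; [rewrite opprK E2|rewrite E1' E1|rewrite E4|rewrite -opprD E3]; by ring.
Qed.

(** * Averages of lattice-periodic solutions *)

Section Lattice.
Variables (w1 w2 : 'rV[R]_2).
Hypothesis w12 : lattice_basis w1 w2.

Definition plane_periodic phi := forall z, phi (z + w1) = phi z /\ phi (z + w2) = phi z.

Definition in_basis phi (s t : R) := phi (s *: w1 + t *: w2).

Lemma in_basis_periodic phi : plane_periodic phi -> periodic2 (in_basis phi).
Proof.
move=> H s t; rewrite /in_basis !scalerDl !scale1r addrAC addrA.
by rewrite (H _).1 (H _).2.
Qed.

Lemma in_basis_continuous phi : (forall z, exists p q, has_grad phi z p q) ->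
  forall s t, continuous2 (in_basis phi) s t.
Proof.
move=> H s t; have [p [q g]] := H (s *: w1 + t *: w2).
exact: differentiable2_continuous2 (grad_differentiable2 g).
Qed.

(** [F] and [G] are the components of the field (P, Q) in the basis (w1, w2), so their divergence in
    lattice coordinates is that of (P, Q). *)
Lemma negligible_divergence P Q (X : 'rV[R]_2 -> R) :
  plane_periodic P -> plane_periodic Q ->
  (forall z, exists p q, has_grad X z p q) ->
  (forall z, exists px py qx qy, [/\ has_grad P z px py, has_grad Q z qx qy & px + qy = X z]) ->
  negligible (in_basis X).
Proof.
move=> Pper Qper Xg H; set d := cre w1 * cim w2 - cim w1 * cre w2.
pose F z := d^-1 * (cim w2 * P z + - (cre w2 * Q z)).
pose G z := d^-1 * (- (cim w1 * P z) + cre w1 * Q z).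
apply: (@mean_divergence _ (in_basis F) (in_basis G)).
- by apply: in_basis_periodic => z; rewrite /F !(Pper z).1 !(Pper z).2 (Qper z).1 (Qper z).2.
- by apply: in_basis_periodic => z; rewrite /G !(Pper z).1 !(Pper z).2 (Qper z).1 (Qper z).2.
move=> s t; have [px [py [qx [qy [gP gQ E]]]]] := H (s *: w1 + t *: w2).
have gF := gradZ d^-1 (gradD (gradZ (cim w2) gP) (gradN (gradZ (cre w2) gQ))).
have gG := gradZ d^-1 (gradD (gradN (gradZ (cim w1) gP)) (gradZ (cre w1) gQ)).
have dF := grad_differentiable2 gF; have dG := grad_differentiable2 gG.
do 4 eexists; split; [exact: dF|exact: dG|exact: in_basis_continuous|].
rewrite /in_basis -E /d; field; exact: w12.
Qed.

(** Averaging the system removes the derivatives and leaves a 2x2 complex linear system for the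
    means of U and V, which is invertible off resonance. *)
Lemma negligible_dirac b0 A C U0 U1 V0 V1 : dirac b0 A C U0 U1 V0 V1 ->
  plane_periodic U0 -> plane_periodic U1 -> plane_periodic V0 -> plane_periodic V1 ->
  ~ (cnorm2 C - cnorm2 A = cnorm2 b0 / 4 /\ cdot C A = 0) ->
  negligible (in_basis U0).
Proof.
move=> H U0p U1p V0p V1p nonres.
have Np phi : plane_periodic phi -> plane_periodic (fun z => - phi z).
  by move=> Hp z; rewrite (Hp z).1 (Hp z).2.
set b := cre b0; set b' := cim b0.
set k := cre A - cim C; set k' := cim A + cre C.
set l := cre A + cim C; set l' := cre C - cim A.
have gU0 z : exists p q, has_grad U0 z p q.
  by have [p0 [q0 [p1 [q1 [r0 [s0 [r1 [s1 [[? ? ? ?] _]]]]]]]]] := H z; exists p0, q0.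
have gU1 z : exists p q, has_grad U1 z p q.
  by have [p0 [q0 [p1 [q1 [r0 [s0 [r1 [s1 [[? ? ? ?] _]]]]]]]]] := H z; exists p1, q1.
have gV0 z : exists p q, has_grad V0 z p q.
  by have [p0 [q0 [p1 [q1 [r0 [s0 [r1 [s1 [[? ? ? ?] _]]]]]]]]] := H z; exists r0, s0.
have gV1 z : exists p q, has_grad V1 z p q.
  by have [p0 [q0 [p1 [q1 [r0 [s0 [r1 [s1 [[? ? ? ?] _]]]]]]]]] := H z; exists r1, s1.
pose comb c0 c1 c2 c3 z : R := c0 * U0 z + c1 * U1 z + (c2 * V0 z + c3 * V1 z).
have gcomb c0 c1 c2 c3 z : exists p q, has_grad (comb c0 c1 c2 c3) z p q.
  have [? [? g0]] := gU0 z; have [? [? g1]] := gU1 z.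
  have [? [? g2]] := gV0 z; have [? [? g3]] := gV1 z.
  do 2 eexists; exact: gradD (gradD (gradZ c0 g0) (gradZ c1 g1)) (gradD (gradZ c2 g2) (gradZ c3 g3)).
(* The four real equations are read as divergences of the periodic fields (U0, - U1), (U1, U0), (V0,
   V1) and (V1, - V0). *)
have N1 : negligible (in_basis (comb (- (2 * pi * k)) (2 * pi * k') (pi * b) (- (pi * b')))).
  apply: (negligible_divergence U0p (Np _ U1p)) => // z.
  have [p0 [q0 [p1 [q1 [r0 [s0 [r1 [s1 [[? ? ? ?] [E1 E2 E3 E4]]]]]]]]]] := H z.
  by exists p0, q0, (- p1), (- q1); split; [|exact: gradN|rewrite E1 /comb /k /k' /b /b'; ring].
have N2 : negligible (in_basis (comb (- (2 * pi * k')) (- (2 * pi * k)) (pi * b') (pi * b))).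
  apply: (negligible_divergence U1p U0p) => // z.
  have [p0 [q0 [p1 [q1 [r0 [s0 [r1 [s1 [[? ? ? ?] [E1 E2 E3 E4]]]]]]]]]] := H z.
  by exists p1, q1, p0, q0; split => //; rewrite E2 /comb /k /k' /b /b'; ring.
have N3 : negligible (in_basis (comb (- (pi * b)) (- (pi * b')) (- (2 * pi * l)) (2 * pi * l'))).
  apply: (negligible_divergence V0p V1p) => // z.
  have [p0 [q0 [p1 [q1 [r0 [s0 [r1 [s1 [[? ? ? ?] [E1 E2 E3 E4]]]]]]]]]] := H z.
  by exists r0, s0, r1, s1; split => //; rewrite E3 /comb /l /l' /b /b'; ring.
have N4 : negligible (in_basis (comb (pi * b') (- (pi * b)) (- (2 * pi * l')) (- (2 * pi * l)))).
  apply: (negligible_divergence V1p (Np _ V0p)) => // z.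
  have [p0 [q0 [p1 [q1 [r0 [s0 [r1 [s1 [[? ? ? ?] [E1 E2 E3 E4]]]]]]]]]] := H z.
  by exists r1, s1, (- r0), (- s0); split; [|exact: gradN|rewrite E4 /comb /l /l' /b /b'; ring].
(* pi^2 (g0 + i g1) is the determinant of that system; explicitly g0 = |b0|^2 - 4 (|C|^2 - |A|^2)
   and g1 = 8 <C, A>. *)
pose g0 := 4 * (k * l - k' * l') + b ^+ 2 + b' ^+ 2; pose g1 := 4 * (k * l' + k' * l).
have g_neq0 : g0 ^+ 2 + g1 ^+ 2 != 0.
  apply/eqP => /eqP; rewrite paddr_eq0 ?sqr_ge0// !sqrf_eq0 => /andP[/eqP g00 /eqP g10].
  apply: nonres; move: g00 g10; rewrite /g0 /g1 /k /k' /l /l' /cnorm2 /cdot -/b -/b' => g00 g10.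
  by split; lra.
have pi0 : (pi : R) != 0 by rewrite gt_eqF// pi_gt0.
(* Multiply the first pair by 2 k', the second by b0, add: the V-terms cancel,
   leaving - pi (g0 + i g1) U. *)
have T0 := negligibleD (negligibleD (negligibleZ (2 * l) N1) (negligibleZ (- (2 * l')) N2))
  (negligibleD (negligibleZ b N3) (negligibleZ (- b') N4)).
have T1 := negligibleD (negligibleD (negligibleZ (2 * l) N2) (negligibleZ (2 * l') N1))
  (negligibleD (negligibleZ b N4) (negligibleZ b' N3)).
(* Multiplying by the conjugate g0 - i g1 and taking the real part isolates [U0]. *)
apply: eq_negligible (negligibleZ (- (pi * (g0 ^+ 2 + g1 ^+ 2))^-1)
  (negligibleD (negligibleZ g0 T0) (negligibleZ g1 T1))) => s t.
rewrite /in_basis /comb; move: (U0 _) (U1 _) (V0 _) (V1 _) => x0 x1 y0 y1.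
apply: (mulfI (mulf_neq0 pi0 g_neq0)); rewrite mulNr mulrN mulVKf ?mulf_neq0//.
by rewrite /g0 /g1; ring.
Qed.

End Lattice.
End Dirac.

(** * Holomorphic maps and multipliers *)

Section Quaternion.
Variable R : realType.
Implicit Types (a b c d : R) (p q : 'rV[R]_4).

Lemma qc_qmk a b c d : [/\ qc 0 (qmk a b c d) = a, qc 1 (qmk a b c d) = b,
  qc 2 (qmk a b c d) = c & qc 3 (qmk a b c d) = d].
Proof. by rewrite /qc; split; rewrite mxE inordK. Qed.

Lemma qc0E a b c d : qc 0 (qmk a b c d) = a. Proof. by have [] := qc_qmk a b c d. Qed.
Lemma qc1E a b c d : qc 1 (qmk a b c d) = b. Proof. by have [] := qc_qmk a b c d. Qed.
Lemma qc2E a b c d : qc 2 (qmk a b c d) = c. Proof. by have [] := qc_qmk a b c d. Qed.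
Lemma qc3E a b c d : qc 3 (qmk a b c d) = d. Proof. by have [] := qc_qmk a b c d. Qed.
Definition qcE := (qc0E, qc1E, qc2E, qc3E).

Lemma eq_quat p q : qc 0 p = qc 0 q -> qc 1 p = qc 1 q -> qc 2 p = qc 2 q ->
  qc 3 p = qc 3 q -> p = q.
Proof.
move=> H0 H1 H2 H3; apply/rowP => -[k kn].
rewrite (_ : Ordinal kn = inord k); last by apply/val_inj; rewrite /= inordK.
by case: k kn => [|[|[|[|//]]]] _.
Qed.

Lemma qcD n p q : qc n (p + q) = qc n p + qc n q.
Proof. by rewrite /qc mxE. Qed.

Lemma qcZ n (k : R) p : qc n (k *: p) = k * qc n p.
Proof. by rewrite /qc mxE. Qed.

End Quaternion.

(** * Holomorphy in real coordinates and its spinor form *)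

Section Holomorphic.
Variable R : realType.
Implicit Types (z w v b : 'rV[R]_2) (f : 'rV[R]_2 -> 'rV[R]_4).

Lemma grad_qc f z n : differentiable f z ->
  has_grad (fun z => qc n (f z)) z (qc n ('d f z (cmk 1 0))) (qc n ('d f z (cmk 0 1))).
Proof.
move=> df.
have H := is_diff_comp (differentiableP df) (is_diff_coord (f z) ord0 (inord n)).
apply: is_diff_eq H _; apply/funext => v /=.
have -> : v = cre v *: cmk 1 0 + cim v *: cmk 0 1.
  apply: eq_plane; rewrite ?creD ?cimD ?creZ ?cimZ ?cre_cmk ?cim_cmk; by ring.
rewrite linearD !linearZ /= -[LHS]/(qc n _) qcD !qcZ creD cimD !creZ !cimZ !cre_cmk !cim_cmk.
by ring.
Qed.

Lemma diff_scale_const (phi : 'rV[R]_2 -> R) z (p q : R) (e : 'rV[R]_4) :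
  has_grad phi z p q ->
  is_diff z (fun z => phi z *: e) (fun v => (p * cre v + q * cim v) *: e).
Proof.
move=> [d dE]; apply: DiffDef; first exact: differentiableZl.
by rewrite diffZl// dE.
Qed.

Lemma diff_qmk (f0 f1 f2 f3 : 'rV[R]_2 -> R) z (p0 q0 p1 q1 p2 q2 p3 q3 : R) :
  has_grad f0 z p0 q0 -> has_grad f1 z p1 q1 -> has_grad f2 z p2 q2 ->
  has_grad f3 z p3 q3 ->
  is_diff z (fun z => qmk (f0 z) (f1 z) (f2 z) (f3 z))
    (fun v => qmk (p0 * cre v + q0 * cim v) (p1 * cre v + q1 * cim v)
                  (p2 * cre v + q2 * cim v) (p3 * cre v + q3 * cim v)).
Proof.
move=> g0 g1 g2 g3.
have qmkE (x0 x1 x2 x3 : R) : qmk x0 x1 x2 x3 = x0 *: qmk 1 0 0 0 + x1 *: qmk 0 1 0 0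
    + (x2 *: qmk 0 0 1 0 + x3 *: qmk 0 0 0 1).
  by apply: eq_quat; rewrite !qcD !qcZ !qcE; ring.
rewrite (_ : (fun z => _) = (fun z => f0 z *: qmk 1 0 0 0 + f1 z *: qmk 0 1 0 0
    + (f2 z *: qmk 0 0 1 0 + f3 z *: qmk 0 0 0 1))); last by apply/funext => x; rewrite qmkE.
have H := is_diffD (is_diffD (diff_scale_const (qmk 1 0 0 0) g0) (diff_scale_const (qmk 0 1 0 0) g1))
  (is_diffD (diff_scale_const (qmk 0 0 1 0) g2) (diff_scale_const (qmk 0 0 0 1) g3)).
by apply: is_diff_eq H _; apply/funext => v; rewrite [RHS]qmkE.
Qed.

Definition half_cos b z : R := cos (pi * cdot b z).
Definition half_sin b z : R := sin (pi * cdot b z).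

Lemma half_cos2Dsin2 b z : half_cos b z ^+ 2 + half_sin b z ^+ 2 = 1.
Proof. exact: cos2Dsin2. Qed.

(** N = cos(beta) i - sin(beta) k, because j i = - k; double angle formulas express it through beta
    / 2. *)
Lemma Nnormal_half b z : Nnormal b z =
  qmk 0 (half_cos b z ^+ 2 - half_sin b z ^+ 2) 0 (- (2 * half_cos b z * half_sin b z)).
Proof.
rewrite /Nnormal /qexpj /qi /betaf.
rewrite (_ : 2 * pi * cdot b z = pi * cdot b z + pi * cdot b z); last by ring.
rewrite cosD sinD -/(half_cos b z) -/(half_sin b z).
by apply: eq_quat; rewrite /qmul !qcE; ring.
Qed.

(** The equations express f_y = N f_x. Since N^2 = -1, this also gives - f_x = N f_y, hence the
    condition in every direction v. *)
Lemma holomorphic_qmk b (f0 f1 f2 f3 : 'rV[R]_2 -> R) :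
  (forall z, exists x0 y0 x1 y1 x2 y2 x3 y3,
    let c := half_cos b z in let s := half_sin b z in
    let C := c ^+ 2 - s ^+ 2 in let S := 2 * c * s in
    [/\ has_grad f0 z x0 y0, has_grad f1 z x1 y1,
        has_grad f2 z x2 y2 & has_grad f3 z x3 y3] /\
    [/\ y0 = - (C * x1 - S * x3), y1 = C * x0 + S * x2,
        y2 = - (S * x1 + C * x3) & y3 = C * x2 - S * x0]) ->
  holomorphic b (fun z => qmk (f0 z) (f1 z) (f2 z) (f3 z)).
Proof.
move=> H z; have [x0 [y0 [x1 [y1 [x2 [y2 [x3 [y3 [[g0 g1 g2 g3]]]]]]]]]] := H z.
set c := half_cos b z; set s := half_sin b z => -[E0 E1 E2 E3].
have [d dE] := diff_qmk g0 g1 g2 g3; split => // v.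
rewrite dE Nnormal_half /Jrot /cmul !cre_cmk !cim_cmk -/c -/s.
have K : (c ^+ 2 - s ^+ 2) ^+ 2 + (2 * c * s) ^+ 2 - 1 = 0.
  apply/eqP; rewrite subr_eq0; apply/eqP.
  transitivity ((c ^+ 2 + s ^+ 2) ^+ 2); first by ring.
  by rewrite half_cos2Dsin2 expr1n.
move: K E0 E1 E2 E3; move: (c ^+ 2 - s ^+ 2) (2 * c * s) => C S K E0 E1 E2 E3.
(* In each component the two sides differ by a multiple of C^2 + S^2 - 1, which is where N^2 = -1
   enters. *)
have vanish (x : R) : x * (C ^+ 2 + S ^+ 2 - 1) = 0 by rewrite K mulr0.
apply: eq_quat; rewrite /qmul !qcE; apply/eqP; rewrite -subr_eq0; apply/eqP.
- by apply: etrans (vanish (x0 * cim v)); rewrite E0 E1 E2 E3; ring.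
- by apply: etrans (vanish (x1 * cim v)); rewrite E0 E1 E2 E3; ring.
- by apply: etrans (vanish (x2 * cim v)); rewrite E0 E1 E2 E3; ring.
- by apply: etrans (vanish (x3 * cim v)); rewrite E0 E1 E2 E3; ring.
Qed.

Lemma holomorphic_grad b f z : holomorphic b f -> exists x0 y0 x1 y1 x2 y2 x3 y3,
    let c := half_cos b z in let s := half_sin b z in
    let C := c ^+ 2 - s ^+ 2 in let S := 2 * c * s in
    [/\ has_grad (fun z => qc 0 (f z)) z x0 y0, has_grad (fun z => qc 1 (f z)) z x1 y1,
        has_grad (fun z => qc 2 (f z)) z x2 y2 & has_grad (fun z => qc 3 (f z)) z x3 y3] /\
    [/\ y0 = - (C * x1 - S * x3), y1 = C * x0 + S * x2,
        y2 = - (S * x1 + C * x3) & y3 = C * x2 - S * x0].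
Proof.
move=> /(_ z) [df H]; do 8 eexists; split; first by split; exact: grad_qc.
have -> : cmk 0 1 = Jrot (cmk 1 0) :> 'rV[R]_2.
  by apply: eq_plane; rewrite /Jrot /cmul !cre_cmk !cim_cmk; ring.
by rewrite H Nnormal_half /qmul !qcE; split; ring.
Qed.

(* e^{j beta/2} (u + j v), where j (v0 + i v1) = v0 j - v1 k. *)
Definition spinor b (u0 u1 v0 v1 : 'rV[R]_2 -> R) z :=
  qmk (half_cos b z * u0 z - half_sin b z * v0 z)
      (half_cos b z * u1 z - half_sin b z * v1 z)
      (half_cos b z * v0 z + half_sin b z * u0 z)
      (- (half_cos b z * v1 z + half_sin b z * u1 z)).

Lemma grad_half_cos b z : has_grad (half_cos b) z
  (- half_sin b z * (pi * cre b)) (- half_sin b z * (pi * cim b)).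
Proof. exact: grad_cos_cdot. Qed.

Lemma grad_half_sin b z : has_grad (half_sin b) z
  (half_cos b z * (pi * cre b)) (half_cos b z * (pi * cim b)).
Proof. exact: grad_sin_cdot. Qed.

(** The subtraction formulas for beta - beta / 2 = beta / 2. *)
Lemma rotate_double (c s : R) : c ^+ 2 + s ^+ 2 = 1 ->
  (c ^+ 2 - s ^+ 2) * c + 2 * c * s * s = c /\ 2 * c * s * c - (c ^+ 2 - s ^+ 2) * s = s.
Proof.
move=> cs; split; first by transitivity (c * (c ^+ 2 + s ^+ 2)); [ring|rewrite cs mulr1].
by transitivity (s * (c ^+ 2 + s ^+ 2)); [ring|rewrite cs mulr1].
Qed.

Lemma holomorphic_spinor b (u0 u1 v0 v1 : 'rV[R]_2 -> R) : dirac b 0 0 u0 u1 v0 v1 ->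
  holomorphic b (spinor b u0 u1 v0 v1).
Proof.
move=> H; apply: holomorphic_qmk => z.
have [p0 [q0 [p1 [q1 [r0 [s0 [r1 [s1 [[g0 g1 h0 h1] []]]]]]]]]] := H z.
rewrite !cre0 !cim0 => E1 E2 E3 E4.
have gc := grad_half_cos b z; have gs := grad_half_sin b z.
do 8 eexists; split.
  split; [exact: gradD (gradM gc g0) (gradN (gradM gs h0))
    |exact: gradD (gradM gc g1) (gradN (gradM gs h1))
    |exact: gradD (gradM gc h0) (gradM gs g0)
    |exact: gradN (gradD (gradM gc h1) (gradM gs g1))].
have [D1 D2] := rotate_double (half_cos2Dsin2 b z).
move: D1 D2; set c := half_cos b z; set s := half_sin b z.
move: (c ^+ 2 - s ^+ 2) (2 * c * s) => C S D1 D2.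
(* The Dirac system serves to eliminate all y-derivatives. *)
have q0E : q0 = (p1 + q0) - p1 by ring.
have q1E : q1 = p0 - (p0 - q1) by ring.
have s0E : s0 = r1 - (r1 - s0) by ring.
have s1E : s1 = (r0 + s1) - r0 by ring.
rewrite E2 in q0E; rewrite E1 in q1E; rewrite E4 in s0E; rewrite E3 in s1E.
(* With P = P0 + i P1 and Q = Q0 + i Q1, the x-derivative of the spinor is e^{j beta/2} (P + j Q);
   the added terms come from differentiating e^{j beta/2}. *)
pose P0 := p0 - pi * cre b * v0 z; pose Q0 := r0 + pi * cre b * u0 z.
pose P1 := p1 - pi * cre b * v1 z; pose Q1 := r1 + pi * cre b * u1 z.
split.
- transitivity (- (P1 * (C * c + S * s) + Q1 * (S * c - C * s))).
    by rewrite D1 D2 q0E s0E /P1 /Q1; ring.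
  by rewrite /P1 /Q1; ring.
- transitivity (P0 * (C * c + S * s) + Q0 * (S * c - C * s)).
    by rewrite D1 D2 q1E s1E /P0 /Q0; ring.
  by rewrite /P0 /Q0; ring.
- transitivity (- (P1 * (S * c - C * s) - Q1 * (C * c + S * s))).
    by rewrite D1 D2 q0E s0E /P1 /Q1; ring.
  by rewrite /P1 /Q1; ring.
- transitivity (Q0 * (C * c + S * s) - P0 * (S * c - C * s)).
    by rewrite D1 D2 q1E s1E /P0 /Q0; ring.
  by rewrite /P0 /Q0; ring.
Qed.

(** The four functions are the components u and v of e^{-j beta/2} f = u + j v, which inverts the
    spinor form. *)
Lemma dirac_of_holomorphic b f : holomorphic b f ->
  dirac b 0 0 (fun z => half_cos b z * qc 0 (f z) + half_sin b z * qc 2 (f z))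
    (fun z => half_cos b z * qc 1 (f z) - half_sin b z * qc 3 (f z))
    (fun z => half_cos b z * qc 2 (f z) - half_sin b z * qc 0 (f z))
    (fun z => - (half_cos b z * qc 3 (f z) + half_sin b z * qc 1 (f z))).
Proof.
move=> H z.
have [x0 [y0 [x1 [y1 [x2 [y2 [x3 [y3 [[g0 g1 g2 g3]]]]]]]]]] := holomorphic_grad z H.
have [D1 D2] := rotate_double (half_cos2Dsin2 b z).
have gc := grad_half_cos b z; have gs := grad_half_sin b z.
move=> /= [E0 E1 E2 E3].
do 8 eexists; split.
  split; [exact: gradD (gradM gc g0) (gradM gs g2)
    |exact: gradD (gradM gc g1) (gradN (gradM gs g3))
    |exact: gradD (gradM gc g2) (gradN (gradM gs g0))
    |exact: gradN (gradD (gradM gc g3) (gradM gs g1))].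
rewrite !cre0 !cim0.
move: D1 D2 E0 E1 E2 E3; set c := half_cos b z; set s := half_sin b z.
move: (c ^+ 2 - s ^+ 2) (2 * c * s) => C S D1 D2 E0 E1 E2 E3.
split; apply/eqP; rewrite -subr_eq0; apply/eqP.
- transitivity (c * x0 + s * x2 - (x0 * (C * c + S * s) + x2 * (S * c - C * s))).
    by rewrite E1 E3; ring.
  by rewrite D1 D2; ring.
- transitivity (c * x1 - s * x3 - (x1 * (C * c + S * s) - x3 * (S * c - C * s))).
    by rewrite E0 E2; ring.
  by rewrite D1 D2; ring.
- transitivity (c * x2 - s * x0 - (x2 * (C * c + S * s) - x0 * (S * c - C * s))).
    by rewrite E1 E3; ring.
  by rewrite D1 D2; ring.
- transitivity (x1 * (S * c - C * s) + x3 * (C * c + S * s) - c * x3 - s * x1).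
    by rewrite E0 E2; ring.
  by rewrite D1 D2; ring.
Qed.

End Holomorphic.

(** * Vanishing of nonresonant periodic solutions *)

Section Vanishing.
Variable R : realType.
Implicit Types (z w v b A B C D : 'rV[R]_2).

Lemma sin_pi_int (k : int) : sin (pi * k%:~R) = 0 :> R.
Proof.
have H (n : nat) : sin (pi * n%:R) = 0 :> R.
  by elim: n => [|n IHn]; rewrite ?mulr0 ?sin0// -natr1 mulrDr mulr1 sinDpi IHn oppr0.
by case: k => n; rewrite ?NegzE ?mulrNz ?mulrN ?sinN -?pmulrn H ?oppr0.
Qed.

Lemma cos_pi_int_sqr (k : int) : cos (pi * k%:~R) ^+ 2 = 1 :> R.
Proof. by rewrite cos2sin2 sin_pi_int expr0n subr0. Qed.

Lemma cosD_pi_int x (k : int) : cos (pi * k%:~R + x) = cos (pi * k%:~R) * cos x :> R.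
Proof. by rewrite cosD sin_pi_int mul0r subr0. Qed.

Lemma sinD_pi_int x (k : int) : sin (pi * k%:~R + x) = cos (pi * k%:~R) * sin x :> R.
Proof. by rewrite sinD sin_pi_int mul0r add0r. Qed.

Lemma cosD_2pi_int x (k : int) : cos (2 * pi * k%:~R + x) = cos x :> R.
Proof.
rewrite (_ : 2 * pi * k%:~R + x = pi * k%:~R + (pi * k%:~R + x)); last by ring.
by rewrite !cosD_pi_int mulrA -expr2 cos_pi_int_sqr mul1r.
Qed.

Lemma sinD_2pi_int x (k : int) : sin (2 * pi * k%:~R + x) = sin x :> R.
Proof.
rewrite (_ : 2 * pi * k%:~R + x = pi * k%:~R + (pi * k%:~R + x)); last by ring.
by rewrite !sinD_pi_int mulrA -expr2 cos_pi_int_sqr mul1r.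
Qed.

Lemma dampD A z w : damp A (z + w) = damp A z * damp A w.
Proof. by rewrite /damp cdotDr mulrDr opprD expRD. Qed.

(** A complex factor r under the shift by w becomes m = r exp(- 2 pi <A, w> - 2 pi i <C, w>). The
    parts of m enter through equations so that simplified values can be supplied. *)
Lemma twist_shift A C (U0 U1 : 'rV[R]_2 -> R) z w (r0 r1 m0 m1 : R) :
  U0 (z + w) = r0 * U0 z - r1 * U1 z -> U1 (z + w) = r0 * U1 z + r1 * U0 z ->
  m0 = damp A w * (cos (2 * pi * cdot C w) * r0 + sin (2 * pi * cdot C w) * r1) ->
  m1 = damp A w * (cos (2 * pi * cdot C w) * r1 - sin (2 * pi * cdot C w) * r0) ->
  twist_re A C U0 U1 (z + w) = m0 * twist_re A C U0 U1 z - m1 * twist_im A C U0 U1 z /\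
  twist_im A C U0 U1 (z + w) = m0 * twist_im A C U0 U1 z + m1 * twist_re A C U0 U1 z.
Proof.
move=> E0 E1 -> ->; rewrite /twist_re /twist_im E0 E1 dampD cdotDr (mulrDr (2 * pi)) cosD sinD.
by split; ring.
Qed.

Lemma twist_eq0 A C (U0 U1 : 'rV[R]_2 -> R) z :
  twist_re A C U0 U1 z = 0 -> twist_im A C U0 U1 z = 0 -> U0 z = 0 /\ U1 z = 0.
Proof.
rewrite /twist_re /twist_im; set x := 2 * pi * _.
have dn : damp A z != 0 by rewrite gt_eqF// expR_gt0.
move=> /eqP; rewrite mulf_eq0 (negbTE dn) => /eqP H0.
move=> /eqP; rewrite mulf_eq0 (negbTE dn) => /eqP H1.
rewrite -[U0 z]mul1r -[U1 z]mul1r -(cos2Dsin2 x); split.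
  transitivity (cos x * (cos x * U0 z + sin x * U1 z) - sin x * (cos x * U1 z - sin x * U0 z)).
    by ring.
  by rewrite H0 H1 !mulr0 subr0.
transitivity (sin x * (cos x * U0 z + sin x * U1 z) + cos x * (cos x * U1 z - sin x * U0 z)).
  by ring.
by rewrite H0 H1 !mulr0 addr0.
Qed.

Variables (w1 w2 : 'rV[R]_2).
Hypothesis w12 : lattice_basis w1 w2.

(** The vector whose inner products with [w1] and [w2] are p and q, by Cramer's rule. *)
Definition dual_vector (p q : R) : 'rV[R]_2 :=
  (cre w1 * cim w2 - cim w1 * cre w2)^-1 *:
    cmk (p * cim w2 - q * cim w1) (q * cre w1 - p * cre w2).

Lemma cdot_dual_vector (p q s t : R) :
  cdot (dual_vector p q) (s *: w1 + t *: w2) = p * s + q * t.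
Proof.
rewrite /dual_vector /cdot !creD !cimD !creZ !cimZ !cre_cmk !cim_cmk; field.
exact: w12.
Qed.

Lemma inDual_dual_vector (m n : int) : inDual w1 w2 (dual_vector m%:~R n%:~R).
Proof.
move=> g [k [l ->]]; exists (m * k + n * l).
by rewrite cdot_dual_vector intrD !intrM.
Qed.

Lemma inLat_w1 : inLat w1 w2 w1.
Proof. by exists 1, 0; rewrite scale1r scale0r addr0. Qed.

Lemma inLat_w2 : inLat w1 w2 w2.
Proof. by exists 0, 1; rewrite scale1r scale0r add0r. Qed.

Lemma inDualN D : inDual w1 w2 D -> inDual w1 w2 (- D).
Proof. by move=> H g /H[k Hk]; exists (- k); rewrite cdotNl Hk intrN. Qed.

Lemma twist_periodic D (U0 U1 : 'rV[R]_2 -> R) : inDual w1 w2 D ->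
  plane_periodic w1 w2 U0 -> plane_periodic w1 w2 U1 ->
  plane_periodic w1 w2 (twist_re 0 D U0 U1) /\ plane_periodic w1 w2 (twist_im 0 D U0 U1).
Proof.
move=> DD p0 p1.
have d0 w : damp 0 w = 1 by rewrite /damp /cdot cre0 cim0 !mul0r addr0 mulr0 oppr0 expR0.
have sh w : inLat w1 w2 w -> (forall z, U0 (z + w) = U0 z) ->
    (forall z, U1 (z + w) = U1 z) -> forall z,
    twist_re 0 D U0 U1 (z + w) = twist_re 0 D U0 U1 z /\
    twist_im 0 D U0 U1 (z + w) = twist_im 0 D U0 U1 z.
  move=> /DD[k kE] H0 H1 z.
  have := @twist_shift 0 D U0 U1 z w 1 0 1 0.
  rewrite kE -[2 * pi * _]addr0 cosD_2pi_int sinD_2pi_int cos0 sin0 d0 H0 H1.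
  by rewrite !(mul1r, mul0r, mulr0, subr0, addr0); apply.
have sh1 := sh w1 inLat_w1 (fun z => (p0 z).1) (fun z => (p1 z).1).
have sh2 := sh w2 inLat_w2 (fun z => (p0 z).2) (fun z => (p1 z).2).
by split => z; have [] := sh1 z; have [] := sh2 z.
Qed.

Definition nonresonant b A C := forall D, inDual w1 w2 D ->
  ~ (cnorm2 (C + D) - cnorm2 A = cnorm2 b / 4 /\ cdot (C + D) A = 0).

(** Twisting by a dual vector D keeps periodicity and moves C to C + D, still off resonance. So
    every Fourier mode of [U0] has negligible mean, and Fourier uniqueness applies at the origin. *)
Lemma dirac_vanish0 b A C (U0 U1 V0 V1 : 'rV[R]_2 -> R) : dirac b A C U0 U1 V0 V1 ->
  plane_periodic w1 w2 U0 -> plane_periodic w1 w2 U1 ->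
  plane_periodic w1 w2 V0 -> plane_periodic w1 w2 V1 ->
  nonresonant b A C -> U0 0 = 0.
Proof.
move=> H p0 p1 r0 r1 nonres.
have neg D : inDual w1 w2 D -> negligible (in_basis w1 w2 (twist_re 0 D U0 U1)).
  move=> DD; have [a0 a1] := twist_periodic DD p0 p1.
  have [b0 b1] := twist_periodic DD r0 r1.
  have K := dirac_twist 0 D H; rewrite addr0 in K.
  apply: (negligible_dirac w12 K a0 a1 b0 b1); exact: nonres.
have -> : U0 0 = in_basis w1 w2 U0 0 0 by rewrite /in_basis !scale0r addr0.
apply: fourier_uniqueness; first exact: in_basis_periodic.
  apply: in_basis_continuous => z.
  by have [x0 [y0 [? [? [? [? [? [? [[? _ _ _] _]]]]]]]]] := H z; exists x0, y0.
move=> m n; have DD := inDual_dual_vector m n.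
(* The half-sum of the twists by D and - D drops the sine term and leaves [U0] times a cosine
   wave. *)
apply: eq_negligible (negligibleZ 2^-1 (negligibleD (neg _ DD) (neg _ (inDualN DD)))) => s t.
rewrite /in_basis /twist_re /wave cdotNl cdot_dual_vector mulrN cosN sinN.
rewrite /damp /cdot cre0 cim0 !mul0r addr0 mulr0 oppr0 expR0.
by field.
Qed.

(** Translation carries the vanishing of [U0] from the origin to every point and rotation carries it
    to [U1]. With U = 0 the first complex equation reads pi b V = 0, and b is nonzero. *)
Lemma dirac_vanish b A C (U0 U1 V0 V1 : 'rV[R]_2 -> R) : b != 0 -> dirac b A C U0 U1 V0 V1 ->
  plane_periodic w1 w2 U0 -> plane_periodic w1 w2 U1 ->
  plane_periodic w1 w2 V0 -> plane_periodic w1 w2 V1 ->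
  nonresonant b A C -> forall z, [/\ U0 z = 0, U1 z = 0, V0 z = 0 & V1 z = 0].
Proof.
move=> b_neq0 H p0 p1 r0 r1 nonres.
have sh phi z0 : plane_periodic w1 w2 phi -> plane_periodic w1 w2 (fun z => phi (z + z0)).
  by move=> p z; rewrite ![z + _ + z0]addrAC (p _).1 (p _).2.
have opp phi : plane_periodic w1 w2 phi -> plane_periodic w1 w2 (fun z => - phi z).
  by move=> p z; rewrite (p _).1 (p _).2.
have U00 z : U0 z = 0.
  have := dirac_vanish0 (dirac_shift z H) (sh _ z p0) (sh _ z p1) (sh _ z r0) (sh _ z r1) nonres.
  by rewrite add0r.
have U10 z : U1 z = 0.
  have := dirac_vanish0 (dirac_shift z (dirac_rotate H)) (sh _ z p1) (sh _ z (opp _ p0))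
    (sh _ z r1) (sh _ z (opp _ r0)) nonres.
  by rewrite add0r.
move=> z; have [x0 [y0 [x1 [y1 [? [? [? [? [[g0 g1 _ _] [E1 E2 _ _]]]]]]]]]] := H z.
have flat phi x y : (forall z, phi z = 0) -> has_grad phi z x y -> x = 0 /\ y = 0.
  move=> phi0; rewrite (_ : phi = fun=> 0); last by apply/funext.
  by move=> g; exact: grad_unique g (grad_cst 0 z).
have [x00 y00] := flat _ _ _ U00 g0; have [x10 y10] := flat _ _ _ U10 g1.
have pi0 := pi_gt0 R.
have {}E1 : cre b * V0 z - cim b * V1 z = 0.
  apply: (mulfI (lt0r_neq0 pi0)); rewrite mulr0; move: E1; rewrite x00 y10 U00 U10 => E1.
  by rewrite -[LHS]subr0 -[RHS](subrr 0) E1; ring.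
have {}E2 : cre b * V1 z + cim b * V0 z = 0.
  apply: (mulfI (lt0r_neq0 pi0)); rewrite mulr0; move: E2; rewrite x10 y00 U00 U10 => E2.
  by rewrite -[LHS]subr0 -[RHS](addr0 0) E2; ring.
have bb : cre b ^+ 2 + cim b ^+ 2 != 0.
  apply: contra_neq b_neq0 => /eqP; rewrite paddr_eq0 ?sqr_ge0// !sqrf_eq0.
  by move=> /andP[/eqP ? /eqP ?]; apply: eq_plane; rewrite ?cre0 ?cim0.
split => //; apply: (mulfI bb); rewrite mulr0.
  transitivity (cre b * (cre b * V0 z - cim b * V1 z) + cim b * (cre b * V1 z + cim b * V0 z)).
    by ring.
  by rewrite E1 E2 !mulr0 addr0.
transitivity (cre b * (cre b * V1 z + cim b * V0 z) - cim b * (cre b * V0 z - cim b * V1 z)).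
  by ring.
by rewrite E1 E2 !mulr0 subr0.
Qed.

(** e^{j beta/2} changes by the sign e = (-1)^k under w, so u and v must carry the factor e h for
    the two signs to cancel. *)
Lemma spinor_shift b (u0 u1 v0 v1 : 'rV[R]_2 -> R) z w (k : int) (h : 'rV[R]_2) :
  let e := cos (pi * k%:~R) in cdot b w = k%:~R ->
  u0 (z + w) = e * cre h * u0 z - e * cim h * u1 z ->
  u1 (z + w) = e * cre h * u1 z + e * cim h * u0 z ->
  v0 (z + w) = e * cre h * v0 z - e * cim h * v1 z ->
  v1 (z + w) = e * cre h * v1 z + e * cim h * v0 z ->
  spinor b u0 u1 v0 v1 (z + w) = qmul (spinor b u0 u1 v0 v1 z) (c2q h).
Proof.
move=> e bw E0 E1 E2 E3.
have ce : half_cos b (z + w) = e * half_cos b z.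
  by rewrite /half_cos cdotDr bw mulrDr addrC cosD_pi_int.
have se : half_sin b (z + w) = e * half_sin b z.
  by rewrite /half_sin cdotDr bw mulrDr addrC sinD_pi_int.
have ee (x : R) : x = e ^+ 2 * x by rewrite cos_pi_int_sqr mul1r.
rewrite /spinor ce se E0 E1 E2 E3; apply: eq_quat; rewrite /qmul /c2q !qcE;
  rewrite [RHS]ee; ring.
Qed.

End Vanishing.

(** * Multipliers as exponentials of pairs (A, B) *)

Section Multiplier.
Variable R : realType.
Implicit Types (z w v b A B C D : 'rV[R]_2) (h : 'rV[R]_2 -> 'rV[R]_2).

Lemma cre_cmul z w : cre (cmul z w) = cre z * cre w - cim z * cim w.
Proof. exact: cre_cmk. Qed.
Lemma cim_cmul z w : cim (cmul z w) = cre z * cim w + cim z * cre w.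
Proof. exact: cim_cmk. Qed.

Lemma plane_neq0 z : (z != 0) = (0 < cre z ^+ 2 + cim z ^+ 2).
Proof.
rewrite lt0r addr_ge0 ?sqr_ge0// andbT paddr_eq0 ?sqr_ge0// !sqrf_eq0.
congr (~~ _); apply/eqP/andP => [->|[/eqP z0 /eqP z1]]; first by rewrite cre0 cim0 eqxx.
by apply: eq_plane; rewrite ?z0 ?z1 ?cre0 ?cim0.
Qed.

Lemma cmulI z w w' : z != 0 -> cmul z w = cmul z w' -> w = w'.
Proof.
rewrite plane_neq0 => /lt0r_neq0 z0 E.
have E0 := congr1 (@cre R) E; have E1 := congr1 (@cim R) E.
rewrite !cre_cmul in E0; rewrite !cim_cmul in E1.
apply: eq_plane; apply: (mulfI z0).
  transitivity (cre z * (cre z * cre w - cim z * cim w)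
    + cim z * (cre z * cim w + cim z * cre w)); first by ring.
  by rewrite E0 E1; ring.
transitivity (cre z * (cre z * cim w + cim z * cre w)
    - cim z * (cre z * cre w - cim z * cim w)); first by ring.
by rewrite E0 E1; ring.
Qed.

Lemma cre_hAB A B z :
  cre (hAB A B z) = expR (2 * pi * cdot A z) * cos (2 * pi * cdot B z).
Proof. by rewrite /hAB creZ cre_cmk. Qed.

Lemma cim_hAB A B z :
  cim (hAB A B z) = - (expR (2 * pi * cdot A z) * sin (2 * pi * cdot B z)).
Proof. by rewrite /hAB cimZ cim_cmk mulrN. Qed.

Lemma norm_hAB A B z :
  cre (hAB A B z) ^+ 2 + cim (hAB A B z) ^+ 2 = expR (2 * pi * cdot A z) ^+ 2.
Proof.
rewrite cre_hAB cim_hAB sqrrN !exprMn -mulrDr cos2Dsin2 mulr1 //.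
Qed.

Lemma hAB_neq0 A B z : hAB A B z != 0.
Proof. by rewrite plane_neq0 norm_hAB exprn_gt0// expR_gt0. Qed.

Lemma hABD A B z w : hAB A B (z + w) = cmul (hAB A B z) (hAB A B w).
Proof.
apply: eq_plane; rewrite ?cre_cmul ?cim_cmul ?cre_hAB ?cim_hAB !cdotDr !(mulrDr (2 * pi)) expRD.
  by rewrite cosD; ring.
by rewrite sinD; ring.
Qed.

Lemma polar_form z : z != 0 -> exists r t : R,
  expR r * cos t = cre z /\ - (expR r * sin t) = cim z.
Proof.
rewrite plane_neq0 => z0; set n := Num.sqrt (cre z ^+ 2 + cim z ^+ 2).
have n0 : 0 < n by rewrite sqrtr_gt0.
have n2 : n ^+ 2 = cre z ^+ 2 + cim z ^+ 2 by rewrite sqr_sqrtr// ltW.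
have x1 : -1 <= cre z / n <= 1.
  rewrite -ler_norml normrM normfV (gtr0_norm n0) ler_pdivrMr// mul1r.
  by rewrite -(@ler_pXn2r _ 2) ?nnegrE ?(ltW n0)// real_normK ?num_real// n2 lerDl sqr_ge0.
have s2 : Num.sqrt (1 - (cre z / n) ^+ 2) = `|cim z| / n.
  rewrite (_ : 1 - _ = (cim z / n) ^+ 2); first by rewrite sqrtr_sqr normrM normfV (gtr0_norm n0).
  by rewrite !expr_div_n n2; field; rewrite gt_eqF.
have enr (x : R) : expR (ln n) * (x / n) = x by rewrite lnK// mulrCA divff ?mulr1 ?gt_eqF.
(* The sine of an arccosine is nonnegative while the imaginary part is - exp(r) sin(t), so the angle
   is negated exactly when Im z >= 0. *)
have [z1|z1] := leP 0 (cim z).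
  exists (ln n), (- acos (cre z / n)).
  by rewrite cosN sinN acosK ?in_itv// sin_acos// s2 ger0_norm// mulrN opprK !enr.
exists (ln n), (acos (cre z / n)).
by rewrite acosK ?in_itv// sin_acos// s2 ltr0_norm// mulNr mulrN opprK !enr.
Qed.

(** The fractional part x of t satisfies sin(pi x) = 0 and 0 <= x < 1, and sine is positive on (0,
    pi). *)
Lemma cos_2pi_eq1 (t : R) : cos (2 * pi * t) = 1 -> exists k : int, t = k%:~R.
Proof.
move=> ct; exists (Num.floor t).
have /andP[f0 f1] := floor_itv t; rewrite intrD in f1.
set k := Num.floor t in f0 f1 *.
have ck : cos (2 * pi * (t - k%:~R)) = 1.
  by rewrite -(cosD_2pi_int _ k) -mulrDr addrC subrK.
have pi0 := pi_gt0 R.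
have sk : sin (pi * (t - k%:~R)) = 0.
  move: ck; rewrite (_ : 2 * pi * _ = (pi * (t - k%:~R)) *+ 2); last by rewrite -mulr_natr; ring.
  rewrite cos_mulr2n cos2sin2 => ck; apply/eqP; rewrite -sqrf_eq0; apply/eqP.
  by move: ck; rewrite -mulr_natr; lra.
have [|tk] := ltP k%:~R t; last by apply/eqP; rewrite eq_le tk f0.
move=> kt; have := @sin_gt0_pi R (pi * (t - k%:~R)).
rewrite sk ltxx mulr_gt0 ?subr_gt0//= gtr_pMr//; rewrite ltrBlDl.
by move=> /(_ f1).
Qed.

Variables (w1 w2 : 'rV[R]_2).
Hypothesis w12 : lattice_basis w1 w2.

Lemma inLatD z w : inLat w1 w2 z -> inLat w1 w2 w -> inLat w1 w2 (z + w).
Proof.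
move=> [m [n ->]] [m' [n' ->]]; exists (m + m'), (n + n').
by rewrite !intrD !scalerDl addrACA.
Qed.

Lemma inLatZ z (k : int) : inLat w1 w2 z -> inLat w1 w2 (k%:~R *: z).
Proof.
move=> [m [n ->]]; exists (k * m), (k * n).
by rewrite !intrM scalerDr !scalerA.
Qed.

Lemma lat_hom_hAB A B : lat_hom w1 w2 (hAB A B).
Proof. by split => [g _|g g' _ _]; [exact: hAB_neq0|exact: hABD]. Qed.

Lemma lat_hom_0 h : lat_hom w1 w2 h -> h 0 = cmk 1 0.
Proof.
move=> [h0 hD]; have L0 : inLat w1 w2 0 by exists 0, 0; rewrite !scale0r addr0.
apply: (cmulI (h0 0 L0)); rewrite -hD// addr0.
by apply: eq_plane; rewrite ?cre_cmul ?cim_cmul !cre_cmk !cim_cmk; ring.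
Qed.

Lemma lat_hom_eq h h' : lat_hom w1 w2 h -> lat_hom w1 w2 h' ->
  h w1 = h' w1 -> h w2 = h' w2 -> forall z, inLat w1 w2 z -> h z = h' z.
Proof.
move=> hh hh' e1 e2.
have Lw1 := inLat_w1 w1 w2; have Lw2 := inLat_w2 w1 w2.
have eD z w : inLat w1 w2 z -> inLat w1 w2 w -> h z = h' z -> h w = h' w ->
    h (z + w) = h' (z + w).
  by move=> Lz Lw ez ew; rewrite hh.2// hh'.2// ez ew.
have eZ z (k : int) : inLat w1 w2 z -> h z = h' z -> h (k%:~R *: z) = h' (k%:~R *: z).
  move=> Lz ez.
  have en (n : nat) : h (n%:R *: z) = h' (n%:R *: z).
    elim: n => [|n IHn]; first by rewrite scale0r !lat_hom_0.
    by rewrite -natr1 scalerDl scale1r; apply: eD => //; exact: (inLatZ (n : int)).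
  case: k => [n|n]; first exact: en.
  (* A negative multiple is reached by cancelling h(m z) in h(m z) h(- m z) = h(0) = 1. *)
  rewrite NegzE; set m := n.+1.
  have Lm := inLatZ (m : int) Lz; have LNm := inLatZ (- (m : int)) Lz.
  apply: (cmulI (hh.1 _ Lm)); rewrite -hh.2// [in RHS](en m) -hh'.2//.
  by rewrite -scalerDl -intrD subrr scale0r !lat_hom_0.
by move=> _ [m [n ->]]; apply: eD; try exact: inLatZ; exact: eZ.
Qed.

Lemma dual_vector_w1 (p q : R) : cdot (dual_vector w1 w2 p q) w1 = p.
Proof.
by have := cdot_dual_vector w12 p q 1 0; rewrite scale1r scale0r addr0 mulr1 mulr0 addr0.
Qed.

Lemma dual_vector_w2 (p q : R) : cdot (dual_vector w1 w2 p q) w2 = q.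
Proof.
by have := cdot_dual_vector w12 p q 0 1; rewrite scale1r scale0r add0r mulr1 mulr0 add0r.
Qed.

(** Logarithms of h(w1) and h(w2) prescribe the inner products of A and B with the basis. *)
Lemma hAB_exists h : lat_hom w1 w2 h ->
  exists A B, forall z, inLat w1 w2 z -> hAB A B z = h z.
Proof.
move=> hh; have pi2 : 2 * pi != 0 :> R by rewrite mulf_neq0// gt_eqF// pi_gt0.
have [r1 [t1 [E1 F1]]] := polar_form (hh.1 _ (inLat_w1 w1 w2)).
have [r2 [t2 [E2 F2]]] := polar_form (hh.1 _ (inLat_w2 w1 w2)).
exists (dual_vector w1 w2 (r1 / (2 * pi)) (r2 / (2 * pi))).
exists (dual_vector w1 w2 (t1 / (2 * pi)) (t2 / (2 * pi))).
apply: lat_hom_eq => //; first exact: lat_hom_hAB.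
  by apply: eq_plane; rewrite ?cre_hAB ?cim_hAB !dual_vector_w1 ![2 * pi * _]mulrC !divfK.
by apply: eq_plane; rewrite ?cre_hAB ?cim_hAB !dual_vector_w2 ![2 * pi * _]mulrC !divfK.
Qed.

Lemma cdot_inj A A' : cdot A w1 = cdot A' w1 -> cdot A w2 = cdot A' w2 -> A = A'.
Proof.
rewrite /cdot => E1 E2; apply: eq_plane; apply: (mulfI w12).
  transitivity (cim w2 * (cre A * cre w1 + cim A * cim w1)
    - cim w1 * (cre A * cre w2 + cim A * cim w2)); first by ring.
  by rewrite E1 E2; ring.
transitivity (cre w1 * (cre A * cre w2 + cim A * cim w2)
    - cre w2 * (cre A * cre w1 + cim A * cim w1)); first by ring.
by rewrite E1 E2; ring.
Qed.

(** The modulus of the multiplier determines <A, .> on the lattice, hence A; the phase determines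
    <B, .> modulo the integers. *)
Lemma hAB_unique A B A' B' :
  (forall z, inLat w1 w2 z -> hAB A' B' z = hAB A B z) <->
  (A' = A /\ inDual w1 w2 (B' - B)).
Proof.
have pi2 : 2 * pi != 0 :> R by rewrite mulf_neq0// gt_eqF// pi_gt0.
split=> [H|[-> BB] z Lz]; last first.
  have [k kE] := BB z Lz.
  have -> : B' = (B' - B) + B by rewrite subrK.
  by apply: eq_plane; rewrite ?cre_hAB ?cim_hAB cdotDl kE (mulrDr _ k%:~R) ?cosD_2pi_int ?sinD_2pi_int.
have eA z : inLat w1 w2 z -> cdot A' z = cdot A z.
  move=> /H E; have := norm_hAB A' B' z; rewrite E norm_hAB => /eqP.
  by rewrite eqrXn2 ?expR_ge0// => /eqP/expR_inj/(mulfI pi2).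
split; first by apply: cdot_inj; apply: eA; [exact: inLat_w1|exact: inLat_w2].
(* Equal phases turn the cosine of the difference into cos^2 + sin^2 = 1. *)
move=> z Lz; apply: cos_2pi_eq1.
have en : expR (2 * pi * cdot A z) != 0 by rewrite gt_eqF// expR_gt0.
have E0 := congr1 (@cre R) (H z Lz); have E1 := congr1 (@cim R) (H z Lz).
rewrite !cre_hAB eA// in E0; rewrite !cim_hAB eA// in E1.
rewrite cdotDl cdotNl (mulrDr (2 * pi)) mulrN cosB (mulfI en E0) (mulfI en (oppr_inj E1)).
by rewrite -!expr2 cos2Dsin2.
Qed.

End Multiplier.

(** * Resonance and existence of holomorphic sections *)

Section Sections.
Variable R : realType.
Implicit Types (z w v b A B C D : 'rV[R]_2) (h : 'rV[R]_2 -> 'rV[R]_2).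
Variables (w1 w2 : 'rV[R]_2).
Hypothesis w12 : lattice_basis w1 w2.

(* A half-lattice frequency d turns exp(2 pi i <d - B, .>) into the sign
   exp(i pi <b, .>) times exp(- 2 pi i <B, .>) on the lattice. *)
Lemma half_lattice_character b B d w (k : int) :
  inDual w1 w2 (d - 2%:R^-1 *: b) -> inLat w1 w2 w -> cdot b w = k%:~R ->
  cos (2 * pi * cdot (d - B) w) = cos (pi * k%:~R) * cos (2 * pi * cdot B w) /\
  sin (2 * pi * cdot (d - B) w) = - (cos (pi * k%:~R) * sin (2 * pi * cdot B w)).
Proof.
move=> Dd Lw bw; have [l lE] := Dd w Lw.
have -> : 2 * pi * cdot (d - B) w = 2 * pi * l%:~R + (pi * k%:~R + - (2 * pi * cdot B w)).
  by rewrite -lE -bw cdotDl cdotNl [cdot (d - _ *: b) w]cdotDl cdotNl cdotZl; field.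
by rewrite cosD_2pi_int sinD_2pi_int cosD_pi_int sinD_pi_int cosN sinN mulrN.
Qed.

(** With C = b / 2 - B, the frequencies C + D for D in Gamma^* are exactly the delta - B for delta
    in Gamma^* + b / 2, so an empty Gamma^*_{A,B} means nonresonance. *)
Lemma section_vanish b A B (f : 'rV[R]_2 -> 'rV[R]_4) : b != 0 -> inDual w1 w2 b ->
  H0 w1 w2 b (hAB A B) f -> ~ (exists d, GammaAB w1 w2 b A B d) -> f = fun=> 0.
Proof.
move=> b_neq0 Db [fhol fper] nores.
pose C := 2%:R^-1 *: b - B.
have H := dirac_twist A C (dirac_of_holomorphic fhol); rewrite !add0r in H.
move: H; set u0 := fun z => half_cos b z * qc 0 (f z) + _.
set u1 := fun z => half_cos b z * qc 1 (f z) - _.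
set v0 := fun z => half_cos b z * qc 2 (f z) - _.
set v1 := fun z => - (half_cos b z * qc 3 (f z) + _) => H.
have shift w : inLat w1 w2 w -> forall z,
   [/\ twist_re A C u0 u1 (z + w) = twist_re A C u0 u1 z,
       twist_im A C u0 u1 (z + w) = twist_im A C u0 u1 z,
       twist_re A C v0 v1 (z + w) = twist_re A C v0 v1 z &
       twist_im A C v0 v1 (z + w) = twist_im A C v0 v1 z].
  move=> Lw z; have [k kE] := Db w Lw; set e := cos (pi * k%:~R : R).
  have ce : half_cos b (z + w) = e * half_cos b z.
    by rewrite /half_cos cdotDr kE mulrDr addrC cosD_pi_int.
  have se : half_sin b (z + w) = e * half_sin b z.
    by rewrite /half_sin cdotDr kE mulrDr addrC sinD_pi_int.
  (* The half-lattice frequency used here is d = b / 2 itself. *)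
  have half_dual : inDual w1 w2 (2%:R^-1 *: b - 2%:R^-1 *: b).
    by rewrite subrr => g _; exists 0; rewrite /cdot cre0 cim0 !mul0r addr0.
  have [cC sC] := half_lattice_character B half_dual Lw kE.
  rewrite -/e -/C in cC sC.
  set h := hAB A B w.
  have ee : e ^+ 2 = 1 by exact: cos_pi_int_sqr.
  (* The twist cancels the multiplier: modulus against modulus, phase against phase, and the sign e
     against itself. *)
  have m0 : 1 = damp A w * (cos (2 * pi * cdot C w) * (e * cre h)
      + sin (2 * pi * cdot C w) * (e * cim h)).
    rewrite cC sC /h cre_hAB cim_hAB /damp expRN.
    have en : expR (2 * pi * cdot A w) != 0 by rewrite gt_eqF// expR_gt0.
    apply: (mulfI en); rewrite mulVKf// mulr1.
    set x := 2 * pi * cdot B w.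
    transitivity (expR (2 * pi * cdot A w) * (e ^+ 2 * (cos x ^+ 2 + sin x ^+ 2))).
      by rewrite ee cos2Dsin2 !mulr1.
    by ring.
  have m1 : 0 = damp A w * (cos (2 * pi * cdot C w) * (e * cim h)
      - sin (2 * pi * cdot C w) * (e * cre h)).
    by rewrite cC sC /h cre_hAB cim_hAB; ring.
  have fw := fper z w Lw; rewrite -/h in fw.
  have shu0 : u0 (z + w) = e * cre h * u0 z - e * cim h * u1 z.
    by rewrite /u0 /u1 ce se fw /qmul /c2q !qcE; ring.
  have shu1 : u1 (z + w) = e * cre h * u1 z + e * cim h * u0 z.
    by rewrite /u0 /u1 ce se fw /qmul /c2q !qcE; ring.
  have shv0 : v0 (z + w) = e * cre h * v0 z - e * cim h * v1 z.
    by rewrite /v0 /v1 ce se fw /qmul /c2q !qcE; ring.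
  have shv1 : v1 (z + w) = e * cre h * v1 z + e * cim h * v0 z.
    by rewrite /v0 /v1 ce se fw /qmul /c2q !qcE; ring.
  have [-> ->] := twist_shift shu0 shu1 m0 m1.
  have [-> ->] := twist_shift shv0 shv1 m0 m1.
  by split; ring.
have sh1 := shift w1 (inLat_w1 w1 w2); have sh2 := shift w2 (inLat_w2 w1 w2).
have nonres : nonresonant w1 w2 b A C.
  move=> D DD res; apply: nores; exists (2%:R^-1 *: b + D).
  have E : 2%:R^-1 *: b + D - B = C + D by rewrite /C addrAC.
  by split; [rewrite addrAC subrr add0r|rewrite E].
have van := dirac_vanish w12 b_neq0 H _ _ _ _ nonres.
have {}van z : [/\ twist_re A C u0 u1 z = 0, twist_im A C u0 u1 z = 0,
    twist_re A C v0 v1 z = 0 & twist_im A C v0 v1 z = 0].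
  by apply: van => x; have [a1 a2 a3 a4] := sh1 x; have [b1 b2 b3 b4] := sh2 x.
apply/funext => z; have [a0 a1 a2 a3] := van z.
have [u00 u10] := twist_eq0 a0 a1; have [v00 v10] := twist_eq0 a2 a3.
set c := half_cos b z; set s := half_sin b z.
have cs : c ^+ 2 + s ^+ 2 = 1 by exact: half_cos2Dsin2.
have q0 (n : nat) : qc n (0 : 'rV[R]_4) = 0 by rewrite /qc mxE.
apply: eq_quat; rewrite q0 -[LHS]mul1r -cs.
- transitivity (c * u0 z - s * v0 z); first by rewrite /u0 /v0 -/c -/s; ring.
  by rewrite u00 v00 !mulr0 subr0.
- transitivity (c * u1 z - s * v1 z); first by rewrite /u1 /v1 -/c -/s; ring.
  by rewrite u10 v10 !mulr0 subr0.
- transitivity (c * v0 z + s * u0 z); first by rewrite /u0 /v0 -/c -/s; ring.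
  by rewrite u00 v00 !mulr0 addr0.
- transitivity (- (c * v1 z + s * u1 z)); first by rewrite /u1 /v1 -/c -/s; ring.
  by rewrite u10 v10 !mulr0 addr0 oppr0.
Qed.

Lemma holomorphic_mulr b (f : 'rV[R]_2 -> 'rV[R]_4) (c : 'rV[R]_2) :
  holomorphic b f -> holomorphic b (fun z => qmul (f z) (c2q c)).
Proof.
move=> H.
rewrite (_ : (fun z => _) = (fun z => qmk
  (cre c * qc 0 (f z) + - cim c * qc 1 (f z)) (cre c * qc 1 (f z) + cim c * qc 0 (f z))
  (cre c * qc 2 (f z) + cim c * qc 3 (f z)) (cre c * qc 3 (f z) + - cim c * qc 2 (f z)))).
  apply: holomorphic_qmk => z.
  have [x0 [y0 [x1 [y1 [x2 [y2 [x3 [y3 [[g0 g1 g2 g3]]]]]]]]]] := holomorphic_grad z H.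
  move=> /= [E0 E1 E2 E3]; do 8 eexists; split.
    split; [exact: gradD (gradZ _ g0) (gradZ _ g1)|exact: gradD (gradZ _ g1) (gradZ _ g0)
      |exact: gradD (gradZ _ g2) (gradZ _ g3)|exact: gradD (gradZ _ g3) (gradZ _ g2)].
  by rewrite E0 E1 E2 E3; split; ring.
apply/funext => z; apply: eq_quat; rewrite /qmul /c2q !qcE; ring.
Qed.

(** At resonance the system with parameters A and delta - B has a nonzero constant solution; undoing
    the twist gives an exponential solution with multiplier h^{A,B}, and its right complex multiples
    form the line. *)
Lemma section_line b A B d : b != 0 -> inDual w1 w2 b -> GammaAB w1 w2 b A B d ->
  exists L, complex_line L /\ (forall a, L a -> H0 w1 w2 b (hAB A B) a).
Proof.
move=> b_neq0 Db [Dd [res1 res2]]; set C := d - B in res1 res2.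
(* U = b and V = 2 (A + i C) solve the first equation identically; the second is then the resonance
   condition. *)
pose x0 := cre b; pose x1 := cim b.
pose y0 := 2 * (cre A - cim C); pose y1 := 2 * (cim A + cre C).
have cst_dirac : dirac b A C (fun=> x0) (fun=> x1) (fun=> y0) (fun=> y1).
  move=> z; do 8 eexists; split; first by split; exact: grad_cst.
  move: res1 res2; rewrite /cnorm2 /cdot => res1 res2.
  split; rewrite /x0 /x1 /y0 /y1.
  - by ring.
  - by ring.
  - rewrite addr0; transitivity (pi * (4 * (cre C * cre C + cim C * cim C
        - (cre A * cre A + cim A * cim A)) - (cre b * cre b + cim b * cim b))); last by ring.
    by rewrite res1; field.
  - rewrite subr0; transitivity (pi * (- 8 * (cre C * cre A + cim C * cim A))); last by ring.
    by rewrite res2 !mulr0.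
have H := dirac_twist (- A) (- C) cst_dirac; rewrite !subrr in H.
set a := spinor b (twist_re (- A) (- C) (fun=> x0) (fun=> x1))
  (twist_im (- A) (- C) (fun=> x0) (fun=> x1))
  (twist_re (- A) (- C) (fun=> y0) (fun=> y1))
  (twist_im (- A) (- C) (fun=> y0) (fun=> y1)).
have ahol : holomorphic b a by exact: holomorphic_spinor.
have aper z w : inLat w1 w2 w -> a (z + w) = qmul (a z) (c2q (hAB A B w)).
  move=> Lw; have [k kE] := Db w Lw.
  have [cC sC] := half_lattice_character B Dd Lw kE.
  rewrite -/C in cC sC; set e := cos (pi * k%:~R : R) in cC sC.
  have tw (r0 r1 : R) := @twist_shift R (- A) (- C) (fun=> r0) (fun=> r1) z w 1 0
    (e * cre (hAB A B w)) (e * cim (hAB A B w)).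
  have {}tw (r0 r1 : R) : twist_re (- A) (- C) (fun=> r0) (fun=> r1) (z + w) =
      e * cre (hAB A B w) * twist_re (- A) (- C) (fun=> r0) (fun=> r1) z
      - e * cim (hAB A B w) * twist_im (- A) (- C) (fun=> r0) (fun=> r1) z /\
    twist_im (- A) (- C) (fun=> r0) (fun=> r1) (z + w) =
      e * cre (hAB A B w) * twist_im (- A) (- C) (fun=> r0) (fun=> r1) z
      + e * cim (hAB A B w) * twist_re (- A) (- C) (fun=> r0) (fun=> r1) z.
    apply: tw; rewrite ?mul1r ?mul0r ?subr0 ?addr0//.
      by rewrite cdotNl mulrN cosN sinN cC sC /damp cdotNl mulrN opprK cre_hAB; ring.
    by rewrite cdotNl mulrN cosN sinN cC sC /damp cdotNl mulrN opprK cim_hAB; ring.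
  by apply: (spinor_shift kE); rewrite -/e; have [? ?] := tw x0 x1; have [? ?] := tw y0 y1.
exists (fun f => exists c : 'rV[R]_2, f = fun z => qmul (a z) (c2q c)); split.
  (* At the origin the twists are trivial and the first two components of [a] are those of b, so [a]
     is nonzero. *)
  exists a; split => // a0; move: b_neq0; rewrite plane_neq0.
  have E0 := congr1 (fun f => qc 0 (f 0)) a0; have E1 := congr1 (fun f => qc 1 (f 0)) a0.
  move: E0 E1; rewrite /a /spinor !qcE /half_cos /half_sin /twist_re /twist_im /damp.
  have c0 w : cdot w 0 = 0 :> R by rewrite /cdot cre0 cim0 !mulr0 addr0.
  rewrite !c0 !mulr0 cos0 sin0 oppr0 expR0 !mul1r !mul0r !addr0 !subr0 /x0 /x1.
  have q0 (n : nat) : qc n (0 : 'rV[R]_4) = 0 by rewrite /qc mxE.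
  by rewrite !q0 => -> ->; rewrite expr0n addr0 ltxx.
move=> _ [c ->]; split; first exact: holomorphic_mulr.
move=> z w Lw; rewrite aper//; apply: eq_quat; rewrite /qmul /c2q !qcE; ring.
Qed.

End Sections.

Theorem theorem2p2 (R : realType) (w1 w2 b0 : 'rV[R]_2)
    (f g : 'rV[R]_2 -> 'rV[R]_4) :
  ham_stationary_torus w1 w2 b0 f g ->
  (* a multiplier in Spec determines (A,B), B unique up to Gamma^* *)
  (forall h, Spec w1 w2 b0 h ->
     exists A B : 'rV[R]_2,
       (forall gam, inLat w1 w2 gam -> hAB A B gam = h gam) /\
       (forall A' B' : 'rV[R]_2,
          (forall gam, inLat w1 w2 gam -> hAB A' B' gam = h gam) <->
          (A' = A /\ inDual w1 w2 (B' - B)))) /\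
  (* Spec = { h^{A,B} | Gamma^*_{A,B} nonempty } *)
  (forall h, Spec w1 w2 b0 h <->
     exists A B : 'rV[R]_2,
       (forall gam, inLat w1 w2 gam -> h gam = hAB A B gam) /\
       exists d, GammaAB w1 w2 b0 A B d) /\
  (* each delta in Gamma^*_{A,B} gives a complex line in H^0_{A,B} *)
  (forall A B d : 'rV[R]_2, GammaAB w1 w2 b0 A B d ->
     exists L, complex_line L /\ (forall a, L a -> H0 w1 w2 b0 (hAB A B) a)).
Proof.
move=> [w12 [Db [b_neq0 _]]]; split; [|split].
- move=> h [hh _]; have [A [B AB]] := hAB_exists w12 hh; exists A, B; split => // A' B'.
  rewrite -(hAB_unique w12); split => K gam Lg; first by rewrite K// AB.
  by rewrite K// AB.
- move=> h; split=> [[hh [a [[ahol aper] a_neq0]]]|[A [B [hE [d dP]]]]].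
    have [A [B AB]] := hAB_exists w12 hh; exists A, B; split.
      by move=> gam Lg; rewrite AB.
    apply: contrapT => nores; apply: a_neq0; apply: (section_vanish w12 b_neq0 Db _ nores).
    by split => // z gam Lg; rewrite aper// AB.
  split.
    split=> [gam Lg|gam gam' Lg Lg']; first by rewrite hE// hAB_neq0.
    by rewrite !hE ?hABD//; exact: inLatD.
  have [L [[a [a_neq0 aL]] LH]] := section_line b_neq0 Db dP.
  exists a; split => //.
  have [ahol aper] : H0 w1 w2 b0 (hAB A B) a.
    (* The scalar 1 shows that the generator lies on its own line. *)
    apply: LH; apply/aL; exists (cmk 1 0); apply/funext => z.
    by apply: eq_quat; rewrite /qmul /c2q !qcE cre_cmk cim_cmk; ring.
  by split => // z gam Lg; rewrite aper// hE.
- by move=> A B d dP; exact: section_line dP.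
Qed.
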